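(* Let $S\subset\mathbb{P}^3$ be a smooth cubic surface over $\mathbb{R}$. If $S(\mathbb{R})$ consists of one connected component then $H_S^0(\mathbb{R})=0$. If $S(\mathbb{R})$ consists of two connected components then $H_S^0(\mathbb{R}) \cong \mathbb{Z}/2\mathbb{Z}$. This isomorphism may be given explicitly as follows. Let $P_0$ be a point on the non-convex component. The map \[ [P-P_0] \mapsto \begin{cases} \overline{0} & \text{if } P \text{ is in the non-convex component} \\ \overline{1} & \text{if } P \text{ is in the convex component} \end{cases} \] (for $P\in S(\mathbb{R})$) extends to an isomorphism $H_S^0(\mathbb{R}) \cong \mathbb{Z}/2\mathbb{Z}$.
   Context: For a smooth real cubic surface $S$, it is well known that $S(\mathbb{R})$ has either one or two connected components; when there are two, one is convex and the other is non-convex, and the non-convex component is the one containing all the real lines of $S$ (there are $3$, $7$, $15$ or $27$ real lines). The group $H_S(K)$, for a field $K$ and a smooth cubic surface $S\subset\mathbb{P}^3$ over $K$ (here $K=\mathbb{R}$): A $K$-line is a line $\ell \subset \mathbb{P}^3$ defined over $K$. If $\ell \not\subset S$ is a $K$-line, then $\ell\cdot S = P+Q+R$ denotes the intersection of $\ell$ with $S$ counted with multiplicity. Let $G_S(K)=\bigoplus_{P\in S(K)}\mathbb{Z}\cdot P$ be the free abelian group on $S(K)$. Let $G'_S(K)$ be the subgroup generated by all sums $P+Q+R$ with $P,Q,R\in S(K)$ (not necessarily distinct) such that (i) there is a $K$-line $\ell$ not contained in $S$ with $\ell\cdot S=P+Q+R$, or (ii) there is a $K$-line $\ell$ contained in $S$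 with $P,Q,R\in\ell$. Let $\deg:G_S(K)\to\mathbb{Z}$, $\deg(\sum a_iP_i)=\sum a_i$, let $G''_S(K)=\{D\in G'_S(K):\deg(D)=0\}$, and $H_S(K)=G_S(K)/G''_S(K)$. The image of $D\in G_S(K)$ in $H_S(K)$ is denoted $[D]$. The degree map descends to $\deg:H_S(K)\to\mathbb{Z}$, and $H^0_S(K)=\{D\in H_S(K):\deg(D)=0\}$. *)

(* Defs.v *)
From HB Require Import structures.
From mathcomp Require Import all_boot all_order all_algebra.
From mathcomp Require Import all_classical all_reals all_analysis.
From mathcomp Require Import generic_quotient ring_quotient.
From mathcomp Require Import complex.
From mathcomp Require mpoly freeg.
(* The notations of mpoly clash with those of the analysis library. *)
Import -(notations) mpoly freeg.
Import numFieldNormedType.Exports.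
Import Order.TTheory GRing.Theory Num.Theory.

Set Implicit Arguments.
Unset Strict Implicit.
Unset Printing Implicit Defensive.

Local Open Scope classical_set_scope.
Local Open Scope ring_scope.
Local Open Scope quotient_scope.

Section ProjectiveSpace.
Context (R : realType).

Definition nonzero_vectors : set 'rV[R]_4 := [set x | x != 0].

(* Two nonzero vectors are proportional iff they have the same row space. *)
Definition proportional (x y : nonzero_vectors) : bool :=
  (val x == val y)%MS.

Lemma proportional_equiv : equiv_class_of proportional.
Proof.
split=> [x|x y|y x z]; rewrite /proportional.
- exact/eqmxP.
- by rewrite andbC.
- by move=> /eqmxP xy /eqmxP yz; apply/eqmxP/(eqmx_trans xy yz).
Qed.

Canonical proportional_equiv_rel := EquivRelPack proportional_equiv.

Definition P3 : Type := quotient_topology {eq_quot proportional}.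

HB.instance Definition _ := Topological.on P3.
HB.instance Definition _ := Quotient.on P3.

(* A choice of homogeneous coordinates; everything stated below through hcoord
   is invariant under rescaling. *)
Definition hcoord (P : P3) : 'rV[R]_4 := val (repr P).

(* A real line of P^3 is encoded by a matrix L : 'M_(2, 4) of rank 2 whose
   rows span it. *)
Definition on_line (L : 'M[R]_(2, 4)) (P : P3) : Prop := (hcoord P <= L)%MS.

(* A convex surface: in some affine chart of P^3, the boundary of a convex
   body.  The chart attached to M \in unitmx is x |-> [1 : x] M; its
   complement is an arbitrary plane. *)
Definition is_convex (C : set P3) : Prop :=
  exists (M : 'M[R]_4) (K : set 'rV[R]_3),
    [/\ M \in unitmx, compact K, convex_set K, K° !=set0 &
        C = [set P | exists2 x : 'rV[R]_3, (closure K `\` K°) x &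
                       (hcoord P == row_mx (1%:M : 'M[R]_1) x *m M)%MS]].

Definition components (A : set P3) : set (set P3) :=
  connected_component A @` A.

End ProjectiveSpace.

Section CubicSurface.
Context (R : realType).

Local Notation cubic_form := (mpoly 4 R).
Local Notation C := (R[i]).

Definition complexify (F : cubic_form) : mpoly 4 C :=
  map_mpoly (real_complex R) F.

(* Smoothness over the base field is geometric: the Jacobian criterion is
   imposed at all complex points. *)
Definition smooth (F : cubic_form) : Prop :=
  forall z : 'rV[C]_4, z != 0 ->
    meval (z ord0) (complexify F) = 0 ->
    exists i : 'I_4, meval (z ord0) (complexify (mderiv i F)) != 0.

Definition smooth_cubic (F : cubic_form) : Prop :=
  F \is ishomog1 3 (@mdeg 4) /\ smooth F.

Definition real_points (F : cubic_form) : set (P3 R) :=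
  [set P | meval (hcoord P ord0) F = 0].

Definition line_in (F : cubic_form) (L : 'M[R]_(2, 4)) : Prop :=
  on_line L `<=` real_points F.

(* F(x + T y) as a polynomial in T. *)
Definition line_section (F : cubic_form) (x y : 'rV[R]_4) : {poly R} :=
  mmap polyC (fun i => (x ord0 i)%:P + y ord0 i *: 'X) F.

(* l . S = P + Q + Q' as divisors on l: the order of vanishing at X of the
   restriction of F to l is the multiplicity of X in P + Q + Q'.  As l . S has
   degree 3, all the intersection points are then real. *)
Definition line_cut (F : cubic_form) (L : 'M[R]_(2, 4)) (P Q Q' : P3 R) : Prop :=
  [/\ on_line L P, on_line L Q, on_line L Q' &
      forall (X : P3 R) (y : 'rV[R]_4), (col_mx (hcoord X) y == L)%MS ->
        mup 0 (line_section F (hcoord X) y) = count_mem X [:: P; Q; Q']].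

End CubicSurface.

Section Subgroup.
Context (V : zmodType).

Definition subgroup (A : set V) : Prop :=
  A 0 /\ forall x y, A x -> A y -> A (x - y).

End Subgroup.

Section GroupH.
Context (R : realType) (F : mpoly 4 R).

Definition GS := freeg.FreegDefs.type_of (Phant int) (Phant (real_points F)).
HB.instance Definition _ := GRing.Zmodule.on GS.

(* freeg.Freeg builds a formal sum from a list of (coefficient, point) pairs. *)
Definition pt (P : real_points F) : GS := freeg.Freeg [:: (1, P)].

Definition deg (D : GS) : int := freeg.deg D.

Definition line_sum (D : GS) : Prop :=
  exists P Q Q' : real_points F, D = pt P + pt Q + pt Q' /\
    exists2 L : 'M[R]_(2, 4), row_free L &
      (~ line_in F L /\ line_cut F L (val P) (val Q) (val Q')) \/
      [/\ line_in F L, on_line L (val P), on_line L (val Q) &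
          on_line L (val Q')].

(* The subgroup generated by the line sums. *)
Definition GS' : set GS := smallest (@subgroup GS) line_sum.

Definition GS'' : {pred GS} := fun D => `[< GS' D /\ deg D = 0 >].

Lemma GS''_zmod_closed : zmod_closed GS''.
Proof.
split.
  apply/asboolP; split; last exact: freeg.deg0.
  by move=> A [[]].
move=> x y /asboolP[Gx dx] /asboolP[Gy dy]; apply/asboolP; split.
  by move=> A sA; case: (sA) => -[_ AB] _; apply: AB; [exact: Gx|exact: Gy].
by rewrite /deg freeg.degB -/(deg x) -/(deg y) dx dy subrr.
Qed.

HB.instance Definition _ := GRing.isZmodClosed.Build GS GS'' GS''_zmod_closed.

Definition HS : Type := Quotient.quot (GS'' : zmodClosed GS).
HB.instance Definition _ := GRing.Zmodule.on HS.
HB.instance Definition _ := Quotient.on HS.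

Definition cls (D : GS) : HS := \pi_HS D.

(* Independent of the representative, see degHS_cls. *)
Definition degHS (x : HS) : int := deg (repr x).

Lemma degHS_cls (D : GS) : degHS (cls D) = deg D.
Proof.
have /eqP : cls (repr (cls D)) = cls D by rewrite /cls reprK.
rewrite /cls -Quotient.idealrBE => /asboolP[_].
by rewrite /deg freeg.degB => /eqP; rewrite subr_eq0 => /eqP.
Qed.

Definition deg0 : {pred HS} := fun x => degHS x == 0.

Lemma deg0_zmod_closed : zmod_closed deg0.
Proof.
have cls0 : cls 0 = 0 by exact: raddf0.
have clsB x y : cls (x - y) = cls x - cls y by exact: raddfB.
split; first by rewrite unfold_in /deg0 -cls0 degHS_cls /deg freeg.deg0.
move=> x y; rewrite !unfold_in /deg0 => /eqP dx /eqP dy.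
rewrite -[x]reprK -[y]reprK -!/(cls _) -clsB degHS_cls /deg freeg.degB.
by rewrite -/(deg _) -/(deg _) -/(degHS _) -/(degHS _) dx dy.
Qed.

HB.instance Definition _ := GRing.isZmodClosed.Build HS deg0 deg0_zmod_closed.

Definition HS0 : Type := {x : HS | x \in deg0}.
HB.instance Definition _ := SubType.on HS0.
HB.instance Definition _ := Choice.on HS0.
HB.instance Definition _ := [SubChoice_isSubZmodule of HS0 by <:].

Lemma cls_sub_deg0 (P P0 : real_points F) : cls (pt P - pt P0) \in deg0.
Proof. by rewrite unfold_in /deg0 degHS_cls /deg freeg.degB !freeg.degU. Qed.

(* [P - P0] *)
Definition cls_sub (P P0 : real_points F) : HS0 :=
  exist (fun x : HS => x \in deg0) _ (cls_sub_deg0 P P0).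

Definition comp_of (P : real_points F) : set (P3 R) :=
  connected_component (real_points F) (val P).

End GroupH.

(* Main.v *)
Require Import Defs.
From HB Require Import structures.
From mathcomp Require Import all_boot all_order all_algebra.
From mathcomp Require Import all_classical all_reals all_analysis.
From mathcomp Require Import generic_quotient complex ring lra.
From mathcomp Require mpoly freeg.
Import -(notations) mpoly freeg.
Import numFieldNormedType.Exports.
Import Order.TTheory GRing.Theory Num.Theory.

(** Polarize the cubic form as [F x = T x x x].  Write [P] for the class of a
    point and [c] for the common class of all line sections.

    If a line is tangent at [Q] and passes through [X], then [2 Q + X = c].
    The tangent planes at two points [Q] and [Q'] share a line, and this line
    meets the surface at a real point [X] because 3 is odd; hence
    [2 Q = c - X = 2 Q'] ([class_double]).  So the degree zero classes are killed
    by 2, and every [X] lying on a tangent plane at another point has the same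
    class [c - 2 Q], the base class.

    One component.  If [X] is not of the base class, no tangent plane at another
    point [Y] contains [X], which says that [T x y y] vanishes on the surface at
    [X] only.  Its sign then cuts the surface into two closed sheets
    ([sheet_neighborhood] separates them near [X]), and the surface is
    disconnected ([connected_base_class]).

    Two components.  The third point of a chord from one component to the other
    depends continuously on the chord, so it always lies in the same component:
    call this one [A], the oval, and the other one [B] ([oval_or]).  A line
    through [a] in [A] never touches [B], so that its intersections with [B]
    persist when the line turns around [a]: every line through [a] meets [B], and
    exactly once ([oval_line_meets]).  A line therefore carries an even number of
    points of [A] ([oval_parity]), and counting these points modulo 2 is a
    well-defined morphism.  It is bijective: from each [b] in [B] there is a
    tangent to [A] ([oval_base_class]), so the points of [B] are of the base
    class, and the chords of [A] show that its points have the same class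
    ([oval_same_class]).

    It remains to recognize [A] and [B] by convexity.  A tangent plane to [B]
    does not meet [A] and can be sent to infinity.  In this chart [A] lies on one
    side of each of its tangent planes ([oval_support]), and the points strictly
    on this side of all of them are the points strictly between two points of
    [A]; the union of the chords of [A] is thus a convex body bounded by [A]
    ([is_convex_left]).  If [B] bounded a convex body, a line from [a] in [A] to
    an interior point would leave it at two points of [B]
    ([is_convex_not_right]). *)

Set Implicit Arguments.
Unset Strict Implicit.
Unset Printing Implicit Defensive.

Local Open Scope classical_set_scope.
Local Open Scope card_scope.
Local Open Scope ring_scope.

(** * Polarization of a cubic form *)

Section Polarization.
Context (R : realType).
Local Notation V := 'rV[R]_4.
Implicit Types (F : mpoly 4 R) (T : V -> V -> V -> R).

Record polarization F T : Prop := Polarization {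
  polE : forall x : V, meval (x ord0) F = T x x x;
  polC12 : forall x y z : V, T x y z = T y x z;
  polC23 : forall x y z, T x y z = T x z y;
  pol_linear : forall a x x' y z, T (a *: x + x') y z = a * T x y z + T x' y z;
  pol_deriv : forall i (x : V),
    meval (x ord0) (mderiv i F) = 3 * T x x (delta_mx ord0 i);
  pol_continuous : forall (X : topologicalType) (f g h : X -> V) (s : X),
    {for s, continuous f} -> {for s, continuous g} -> {for s, continuous h} ->
    {for s, continuous (fun s => T (f s) (g s) (h s))} }.

Lemma polarizationD F1 F2 T1 T2 : polarization F1 T1 -> polarization F2 T2 ->
  polarization (F1 + F2) (fun x y z => T1 x y z + T2 x y z).
Proof.
move=> [e1 a1 b1 l1 d1 c1] [e2 a2 b2 l2 d2 c2]; split.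
- by move=> x; rewrite mevalD e1 e2.
- by move=> x y z; rewrite a1 a2.
- by move=> x y z; rewrite b1 b2.
- by move=> a x x' y z; rewrite l1 l2; ring.
- by move=> i x; rewrite mderivD mevalD d1 d2 mulrDr.
- move=> X f g h s cf cg ch; apply: continuousD; [exact: c1|exact: c2].
Qed.

Lemma polarizationZ k F T : polarization F T ->
  polarization (k *: F) (fun x y z => k * T x y z).
Proof.
move=> [e1 a1 b1 l1 d1 c1]; split.
- by move=> x; rewrite mevalZ e1.
- by move=> x y z; rewrite a1.
- by move=> x y z; rewrite b1.
- by move=> a x x' y z; rewrite l1; ring.
- by move=> i x; rewrite mderivZ mevalZ d1; ring.
- move=> X f g h s cf cg ch; apply: continuousM; [exact: cvg_cst|exact: c1].
Qed.

Lemma polarization0 : polarization 0 (fun _ _ _ => 0).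
Proof.
split=> *; rewrite ?mderiv0 ?meval0 ?mulr0 ?addr0 //.
exact: cvg_cst.
Qed.

Lemma polarization_monomial i j k :
  exists T, polarization (mpolyX R (mnm1 i) * mpolyX R (mnm1 j) * mpolyX R (mnm1 k)) T.
Proof.
pose t (x y z : V) := x ord0 i * y ord0 j * z ord0 k.
exists (fun x y z => 6^-1 * (t x y z + t x z y + t y x z + t y z x + t z x y + t z y x)).
split.
- by move=> x; rewrite !mevalM !mevalXU /t; field.
- by move=> x y z; congr (_ * _); rewrite /t; ring.
- by move=> x y z; congr (_ * _); rewrite /t; ring.
- by move=> a x x' y z; rewrite /t !mxE; ring.
- move=> l x; rewrite !mderivM !mevalD !mevalM !mevalD !mevalM !mevalXU.
  have dX m : meval (x ord0) (mderiv l (mpolyX R (mnm1 m))) = (m == l)%:R.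
    rewrite mderivX mnm1E mevalZ mevalX; case: eqP => [->|]; rewrite ?mul0r//.
    rewrite mul1r big1// => n _; rewrite mnmBE subnn expr0 //.
  by rewrite !dX /t !mxE !eqxx !andTb; field.
- have cc (X : topologicalType) (f : X -> V) (s : X) m :
      {for s, continuous f} -> {for s, continuous (fun s => f s ord0 m)}.
    move=> cf; apply: (@continuous_comp _ _ _ f (fun v : V => v ord0 m)) => //.
    exact: coord_continuous.
  move=> X f g h s cf cg ch.
  apply: continuousM; first exact: cvg_cst.
  by do !apply: continuousD; do !apply: continuousM; apply: cc.
Qed.
Lemma mdegS_U (m : multinom 4) d : mdeg m = d.+1 ->
  exists i m', m = mnm_add m' (mnm1 i) /\ mdeg m' = d.
Proof.
move=> dm; have [i mi] : exists i, (0 < m i)%N.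
  apply: contrapT => /forallNP m0; move: dm; rewrite mdegE big1// => i _.
  by apply/eqP; rewrite -leqn0 leqNgt; apply/negP.
exists i, (mnm_sub m (mnm1 i)).
have E : m = mnm_add (mnm_sub m (mnm1 i)) (mnm1 i).
  rewrite submK//; apply/mnm_lepP => j; rewrite mnm1E.
  by case: eqP => // <-.
split=> //; apply/eqP; rewrite -(eqn_add2r 1) -[X in (_ + X)%N](mdeg1 i) -mdegD -E dm.
by rewrite addn1.
Qed.

(** A monomial of degree 3 is a product of three variables, which is symmetrized. *)
Lemma exists_polarization F : F \is ishomog1 3 (@mdeg 4) ->
  exists T, polarization F T.
Proof.
move=> /dhomogP hF; rewrite (mpolyE F).
rewrite big_seq; elim/big_ind : _.
- by exists (fun _ _ _ => 0); exact: polarization0.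
- move=> F1 F2 [T1 p1] [T2 p2].
  by exists (fun x y z => T1 x y z + T2 x y z); exact: polarizationD.
move=> m /hF /mdegS_U[i [m1 [-> /mdegS_U[j [m2 [-> /mdegS_U[k [m3 [-> ]]]]]]]]].
move=> /eqP; rewrite mdeg_eq0 => /eqP ->.
rewrite add0m !mpolyXD; have [T pT] := polarization_monomial k j i.
by eexists; apply: polarizationZ pT.
Qed.

End Polarization.

Section Smooth.
Context (R : realType).
Local Notation V := 'rV[R]_4.
Implicit Types (F : mpoly 4 R).

Definition real_smooth F := forall x : V, x != 0 -> meval (x ord0) F = 0 ->
  exists i, meval (x ord0) (mderiv i F) != 0.

Lemma smooth_real F : smooth F -> real_smooth F.
Proof.
move=> sF x x0 Fx.
have ev (G : mpoly 4 R) : meval (map_mx (real_complex R) x ord0) (complexify G)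
   = real_complex R (meval (x ord0) G).
  rewrite /complexify !raddf_sum /=; apply: eq_bigr => m _.
  rewrite mevalM mevalC mmap1_id mevalX rmorphM /mmap1 rmorph_prod.
  by congr (_ * _); apply: eq_bigr => i _; rewrite mxE rmorphXn.
have [||i] := sF (map_mx (real_complex R) x).
- by rewrite map_mx_eq0.
- by rewrite ev Fx.
by rewrite ev fmorph_eq0 => Fi; exists i.
Qed.
End Smooth.

(** * Homogeneous coordinates *)

Section ProjectivePoints.
Local Open Scope quotient_scope.
Context (R : realType).
Local Notation V := 'rV[R]_4.
Local Notation NZ := (@nonzero_vectors R).
Implicit Types (x y z : V) (P Q : P3 R) (A : set (P3 R)) (C : set V).

Lemma basis_vector_neq0 : NZ (delta_mx ord0 ord0).
Proof.
by apply/eqP => /rowP /(_ ord0); rewrite !mxE !eqxx => /eqP; rewrite oner_eq0.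
Qed.

(** The value at [x = 0] is arbitrary. *)
Definition ppoint x : P3 R :=
  (\pi_(P3 R) (insubd (SigSub (mem_set basis_vector_neq0) : NZ) x))%qT.

Lemma val_nonzero (v : NZ) : val v != 0.
Proof. by case: v => v /= /set_mem. Qed.

Lemma hcoord_neq0 P : hcoord P != 0.
Proof. exact: val_nonzero. Qed.

Lemma ppoint_val (v : NZ) : ppoint (val v) = (\pi_(P3 R) v)%qT.
Proof. by rewrite /ppoint valKd. Qed.

Lemma hcoordK P : ppoint (hcoord P) = P.
Proof. by rewrite /hcoord ppoint_val reprK. Qed.

Lemma insub_nonzero x : x != 0 -> exists v : NZ, val v = x.
Proof. move=> x0; have x1 : NZ x := x0; by exists (SigSub (mem_set x1) : NZ). Qed.

Lemma eqmx_colinear m (x y : 'rV[R]_m) : (x == y)%MS ->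
  exists2 k, k != 0 & x = k *: y.
Proof.
case/andP => /sub_rVP[k xk] /sub_rVP[l yl].
have [k0|k0] := eqVneq k 0; last by exists k.
exists 1; first exact: oner_neq0.
by rewrite scale1r yl xk k0 scale0r scaler0.
Qed.

Lemma colinear_eqmx m (x y : 'rV[R]_m) k : k != 0 -> x = k *: y -> (x == y)%MS.
Proof.
move=> k0 ->; apply/andP; split; first by apply: scalemx_sub.
by rewrite -{1}[y](scalerK k0) scalemx_sub.
Qed.

Lemma ppoint_eqP x y : x != 0 -> y != 0 -> (x == y)%MS <-> ppoint x = ppoint y.
Proof.
move=> /insub_nonzero[v <-] /insub_nonzero[w <-]; rewrite !ppoint_val.
have E := @eqquotP _ _ {eq_quot (@proportional R)} v w.
by split=> [vw|vw]; apply/E.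
Qed.

Lemma ppointZ k x : k != 0 -> x != 0 -> ppoint (k *: x) = ppoint x.
Proof.
move=> k0 x0; apply/ppoint_eqP; rewrite ?scaler_eq0 ?negb_or ?k0//.
exact: (colinear_eqmx k0).
Qed.

Lemma ppoint_colinear x y : x != 0 -> y != 0 -> ppoint x = ppoint y ->
  exists2 k, k != 0 & x = k *: y.
Proof. by move=> x0 y0 /(ppoint_eqP x0 y0)/eqmx_colinear. Qed.

Lemma hcoord_ppoint x : x != 0 -> exists2 k, k != 0 & hcoord (ppoint x) = k *: x.
Proof. by move=> x0; apply: ppoint_colinear; rewrite ?hcoordK ?hcoord_neq0. Qed.

(** Containing the origin makes [cone A] closed as soon as [A] is. *)
Definition cone A : set V := [set x | x = 0 \/ A (ppoint x)].

Definition homogeneous C := forall k x, k != 0 -> C x -> C (k *: x).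

Lemma homogeneous_ppoint C x : homogeneous C -> x != 0 ->
  C (hcoord (ppoint x)) <-> C x.
Proof.
move=> hC x0; have [k k0 ->] := hcoord_ppoint x0; split; last exact: hC.
by move=> /(hC k^-1); rewrite scalerK// invr_eq0 => /(_ k0).
Qed.

Lemma closed_cone A : closed A -> closed (cone A).
Proof.
rewrite -openC => oA.
rewrite -openC.
have [U oU UE] : exists2 U : set V, open U &
   (forall v : NZ, U (val v) <-> ~ A (ppoint (val v))).
  have := oA; rewrite /open /= /quotient_open => -[U oU UE]; exists U => //.
  move=> v; have := congr1 (fun W : set _ => W v) UE.
  by rewrite /= ppoint_val => ->.
have -> : ~` cone A = ~` [set 0] `&` U; last first.
  by apply: openI => //; rewrite openC;
    apply/accessible_closed_set1/hausdorff_accessible.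
apply/seteqP; split => x /=.
- move=> /not_orP[/eqP x0 Ax]; split; first exact/eqP.
  by have [v vx] := insub_nonzero x0; rewrite -vx; apply/UE; rewrite vx.
- move=> [/eqP x0 Ux] [/eqP|]; first by rewrite (negPf x0).
  by have [v vx] := insub_nonzero x0; move: Ux; rewrite -vx => /UE.
Qed.

Lemma open_hcoord C : homogeneous C -> open C -> open [set P | C (hcoord P)].
Proof.
move=> hC oC; rewrite /open /= /quotient_open; exists C => //.
apply/seteqP; split => v /=.
  by rewrite -ppoint_val homogeneous_ppoint// val_nonzero.
by rewrite -ppoint_val homogeneous_ppoint// val_nonzero.
Qed.

(** Sets of points are shown to be closed by equations and inequalities between
    homogeneous coordinates. *)
Lemma closed_hcoord C : homogeneous C -> closed C -> closed [set P | C (hcoord P)].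
Proof.
move=> hC cC; rewrite -openC; apply: (open_hcoord (C := ~` C)); last by rewrite openC.
move=> k x k0 nC /(hC k^-1); rewrite scalerK// invr_eq0.
by move=> /(_ k0).
Qed.
End ProjectivePoints.

(** * Lines of projective space *)

Section Lines.
Context (R : realType).
Local Notation V := 'rV[R]_4.
Implicit Types (x y z : V) (P Q : P3 R).

Definition indep x y := forall s t : R, s *: x + t *: y = 0 -> s = 0 /\ t = 0.

Lemma indep_neq0l x y : indep x y -> x != 0.
Proof.
move=> xy; apply/eqP => x0; have [|/eqP] := xy 1 0.
  by rewrite x0 scaler0 scale0r addr0.
by rewrite oner_eq0.
Qed.

Lemma indepC x y : indep x y -> indep y x.
Proof. by move=> xy s t; rewrite addrC => /xy[-> ->]. Qed.

Lemma indep_neq0r x y : indep x y -> y != 0.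
Proof. by move=> /indepC/indep_neq0l. Qed.

Lemma not_indep x y : x != 0 -> ~ indep x y -> exists k, y = k *: x.
Proof.
move=> x0 nxy; apply: contrapT => /forallNP yx; apply: nxy => s t e.
have t0 : t = 0.
  have [//|t0] := eqVneq t 0; exfalso; apply: (yx (- s / t)).
  have ty : t *: y = - (s *: x) by apply/eqP; rewrite -addr_eq0 addrC e.
  by rewrite -[y](scalerK t0) ty scalerN scalerA -scaleNr; congr (_ *: _); ring.
split=> //; move: e; rewrite t0 scale0r addr0 => /eqP.
by rewrite scaler_eq0 (negPf x0) orbF => /eqP.
Qed.

Lemma indep_ppoint x y : x != 0 -> y != 0 -> ppoint x <> ppoint y -> indep x y.
Proof.
move=> x0 y0 xy; apply: contrapT => /(not_indep x0)[k yk]; apply: xy.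
have k0 : k != 0 by apply: contraNneq y0 => k0; rewrite yk k0 scale0r.
by rewrite yk ppointZ.
Qed.

Lemma ppoint_indep x y : indep x y -> ppoint x <> ppoint y.
Proof.
move=> xy /ppoint_colinear-/(_ (indep_neq0l xy) (indep_neq0r xy))[k k0 E].
have [|/eqP] := xy 1 (- k); first by rewrite E scale1r scaleNr subrr.
by rewrite oner_eq0.
Qed.

(** The determinant of the change of basis decides. *)
Lemma indep_comb x y a b c d : indep x y -> a * d - b * c != 0 ->
  indep (a *: x + b *: y) (c *: x + d *: y).
Proof.
move=> xy D s t; rewrite !scalerDr !scalerA addrACA -!scalerDl => /xy[e1 e2].
have s0 : s * (a * d - b * c) = d * (s * a + t * c) - c * (s * b + t * d) by ring.
have t0 : t * (a * d - b * c) = a * (s * b + t * d) - b * (s * a + t * c) by ring.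
move: s0 t0; rewrite e1 e2 !mulr0 subr0 => /eqP;
  rewrite mulf_eq0 (negPf D) orbF => /eqP->.
by move=> /eqP; rewrite mulf_eq0 (negPf D) orbF => /eqP->.
Qed.

Lemma comb_inj x y a b c d : indep x y ->
  a *: x + b *: y = c *: x + d *: y -> a = c /\ b = d.
Proof.
move=> xy /eqP; rewrite -subr_eq0 opprD addrACA -!scalerBl => /eqP/xy[].
by move=> /eqP; rewrite subr_eq0 => /eqP -> /eqP; rewrite subr_eq0 => /eqP ->.
Qed.

Definition line_span x y : 'M[R]_(2, 4) := col_mx x y.

Lemma sub_line_span x y z : (z <= line_span x y)%MS <-> exists s t, z = s *: x + t *: y.
Proof.
rewrite (_ : (z <= line_span x y)%MS = (z <= x + y)%MS); last by rewrite addsmxE.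
split=> [/sub_addsmxP[[u v] /= ->]|[s [t ->]]].
  by exists (u ord0 ord0), (v ord0 ord0);
    rewrite {1}[u]mx11_scalar {1}[v]mx11_scalar !mul_scalar_mx.
by apply: addmx_sub_adds; apply: scalemx_sub.
Qed.

Lemma line_span_sub m x y (L : 'M[R]_(m, 4)) :
  (line_span x y <= L)%MS = (x <= L)%MS && (y <= L)%MS.
Proof.
have E : (line_span x y <= L)%MS = (x + y <= L)%MS by have [_ /(_ _ L)[-> _]] := addsmxE x y.
by rewrite E addsmx_sub.
Qed.

Lemma row_free_line_span x y : row_free (line_span x y) <-> indep x y.
Proof.
have comb s t : row_mx (s%:M : 'M[R]_1) (t%:M : 'M[R]_1) *m line_span x y = s *: x + t *: y.
  by rewrite mul_row_col !mul_scalar_mx.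
split=> [xyf s t e|xy].
  have : row_mx (s%:M : 'M[R]_1) (t%:M : 'M[R]_1) = 0.
    by apply: (row_free_inj xyf); rewrite /= comb e mul0mx.
  rewrite -row_mx0 => /eq_row_mx[/matrixP/(_ ord0 ord0) s0 /matrixP/(_ ord0 ord0) t0].
  by move: s0 t0; rewrite !mxE /= !mulr1n.
apply: inj_row_free => v.
rewrite -[v](@hsubmxK _ 1 1 1 v) [lsubmx _]mx11_scalar [rsubmx _]mx11_scalar comb.
by move=> /xy[-> ->]; rewrite !raddf0 row_mx0.
Qed.

Lemma line_span_of (L : 'M[R]_(2, 4)) : exists x y, L = line_span x y.
Proof. by exists (usubmx (L : 'M[R]_(1 + 1, 4))), (dsubmx (L : 'M[R]_(1 + 1, 4)));
  rewrite /line_span vsubmxK. Qed.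

Lemma line_span_complete x y z : indep x y -> z != 0 -> (z <= line_span x y)%MS ->
  exists2 w, indep z w & (line_span z w == line_span x y)%MS.
Proof.
move=> xy z0 /sub_line_span[s [t zE]].
have [s0|s0] := eqVneq s 0.
  have t0 : t != 0 by apply: contraNneq z0 => t0; rewrite zE s0 t0 !scale0r addr0.
  exists x.
    have := @indep_comb x y s t 1 0 xy; rewrite scale1r scale0r addr0 -zE; apply.
    by rewrite mulr0 sub0r mulr1 oppr_eq0.
  have sx : (x <= line_span x y)%MS by apply/sub_line_span; exists 1, 0;
    rewrite scale1r scale0r addr0.
  rewrite !line_span_sub sx /=; apply/andP; split; first by rewrite andbT;
    apply/sub_line_span; exists s, t.
  apply/andP; split; apply/sub_line_span.
  - by exists 0, 1; rewrite scale1r scale0r add0r.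
  - by exists t^-1, 0; rewrite zE s0 !scale0r add0r addr0 scalerA mulVf// scale1r.
exists y.
  have := @indep_comb x y s t 0 1 xy; rewrite scale1r scale0r add0r -zE; apply.
  by rewrite mulr0 subr0 mulr1.
have sy : (y <= line_span x y)%MS by apply/sub_line_span; exists 0, 1;
  rewrite scale1r scale0r add0r.
rewrite !line_span_sub sy /=; apply/andP; split; first by rewrite andbT;
  apply/sub_line_span; exists s, t.
apply/andP; split; apply/sub_line_span.
- exists s^-1, (- (s^-1 * t)); rewrite zE scalerDr !scalerA mulVf// scale1r.
  by rewrite scaleNr addrK.
- by exists 0, 1; rewrite scale1r scale0r add0r.
Qed.

End Lines.

(** * Restriction of the form to a line *)

(** The field is infinite. *)
Lemma poly_ext (R : realType) (p q : {poly R}) :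
  (forall t, p.[t] = q.[t]) -> p = q.
Proof.
move=> pq; apply/eqP; rewrite -subr_eq0; apply/eqP.
apply: (@roots_geq_poly_eq0 _ _ [seq n%:R | n <- iota 0 (size (p - q))]).
- by apply/allP => t _; rewrite rootE !hornerE pq subrr.
- rewrite map_inj_uniq ?iota_uniq// => m n /eqP.
  by rewrite eqr_nat => /eqP.
- by rewrite size_map size_iota.
Qed.

Lemma mup_affine (R : realType) (c d : R) : (c != 0) || (d != 0) ->
  mup 0 (c%:P + d *: 'X) = (c == 0).
Proof.
have [->|c0] := eqVneq c 0; last first.
  by move=> _; rewrite mupNroot// rootE !hornerE.
move=> /= d0; rewrite add0r -mul_polyC mupMr ?rootE ?hornerC//.
by have := mup_XsubCX 1 (0 : R) 0; rewrite subr0 expr1 eqxx.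
Qed.

Section PolarAlgebra.
Context (R : realType).
Local Notation V := 'rV[R]_4.
Implicit Types (x y z w : V).
Context (F : mpoly 4 R) (T : V -> V -> V -> R) (pT : polarization F T).

Let tC12 := polC12 pT.
Let tC23 := polC23 pT.

Lemma tri0l y z : T 0 y z = 0.
Proof.
have := pol_linear pT (-1) 0 0 y z; rewrite scaler0 addr0 => {1}->.
by rewrite mulN1r addNr.
Qed.

Lemma triD1 x y z w : T (x + y) z w = T x z w + T y z w.
Proof. by rewrite -[x]scale1r (pol_linear pT) scale1r mul1r. Qed.

Lemma triZ1 k x z w : T (k *: x) z w = k * T x z w.
Proof. by rewrite -[k *: x]addr0 (pol_linear pT) tri0l addr0. Qed.

Lemma triD2 x y z w : T z (x + y) w = T z x w + T z y w.
Proof. by rewrite tC12 triD1 !(tC12 _ z). Qed.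

Lemma triZ2 k x z w : T z (k *: x) w = k * T z x w.
Proof. by rewrite tC12 triZ1 tC12. Qed.

Lemma triD3 x y z w : T z w (x + y) = T z w x + T z w y.
Proof. by rewrite tC23 triD2 !(tC23 z w). Qed.

Lemma triZ3 k x z w : T z w (k *: x) = k * T z w x.
Proof. by rewrite tC23 triZ2 tC23. Qed.

Definition triE := (triD1, triD2, triD3, triZ1, triZ2, triZ3).

(** Brings the values of [T] on words in two vectors to a normal form, to be used
    before [ring]. *)
Lemma tri_sym x y : (T y x x = T x x y) * (T x y x = T x x y) *
  (T y y x = T x y y) * (T y x y = T x y y).
Proof.
by do !split; rewrite // 1?tC12 // 1?tC23 // tC12.
Qed.

Lemma cubic_comb x y s t : T (s *: x + t *: y) (s *: x + t *: y) (s *: x + t *: y) =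
  s ^+ 3 * T x x x + 3 * s ^+ 2 * t * T x x y + 3 * s * t ^+ 2 * T x y y + t ^+ 3 * T y y y.
Proof. by rewrite !triE !(tri_sym x y); ring. Qed.

Lemma cubicZ k x : T (k *: x) (k *: x) (k *: x) = k ^+ 3 * T x x x.
Proof. by rewrite !triE; ring. Qed.

Lemma real_pointsE P : real_points F P <-> T (hcoord P) (hcoord P) (hcoord P) = 0.
Proof. by rewrite -(polE pT). Qed.

Lemma real_points_ppoint x : x != 0 -> real_points F (ppoint x) <-> T x x x = 0.
Proof.
move=> x0; rewrite real_pointsE; have [k k0 ->] := hcoord_ppoint x0.
rewrite cubicZ; split=> [/eqP|->]; last by rewrite mulr0.
by rewrite mulf_eq0 expf_eq0 (negPf k0) andbF /= => /eqP.
Qed.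

Lemma smooth_tri x : real_smooth F -> x != 0 -> T x x x = 0 -> exists y, T x x y != 0.
Proof.
move=> sF x0; rewrite -(polE pT) => Fx; have [i +] := sF _ x0 Fx;
  rewrite (pol_deriv pT) => h.
by exists (delta_mx ord0 i); move: h; apply: contraNN => /eqP ->; rewrite mulr0.
Qed.

(** The bridge between the multiplicities in [line_cut] and the trilinear form. *)
Lemma line_section_horner x y t : (line_section F x y).[t] =
  T (x + t *: y) (x + t *: y) (x + t *: y).
Proof.
rewrite -(polE pT) /line_section /meval /mmap horner_sum; apply: eq_bigr => m _.
rewrite hornerM hornerC; congr (_ * _).
rewrite /mmap1 horner_prod; apply: eq_bigr => i _.
by rewrite horner_exp !hornerE !mxE mulrC.
Qed.
End PolarAlgebra.

Section LineCut.
Context (R : realType).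
Local Notation V := 'rV[R]_4.
Implicit Types (x y z w : V).
Context (F : mpoly 4 R) (T : V -> V -> V -> R) (pT : polarization F T).
Local Notation cub x := (T x x x).

Lemma on_line_ppoint (L : 'M[R]_(2, 4)) x : x != 0 ->
  on_line L (ppoint x) <-> (x <= L)%MS.
Proof.
move=> x0; rewrite /on_line; have [k k0 ->] := hcoord_ppoint x0.
by rewrite eqmx_scale.
Qed.

Lemma ppoint_eq_det x y a b c d : indep x y ->
  a *: x + b *: y != 0 -> c *: x + d *: y != 0 ->
  ppoint (a *: x + b *: y) = ppoint (c *: x + d *: y) <-> a * d - b * c = 0.
Proof.
move=> xy X0 Y0; split=> [/(ppoint_colinear X0 Y0)[k _]|D].
  by rewrite scalerDr !scalerA => /(comb_inj xy)[-> ->]; ring.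
apply: contrapT => /(indep_ppoint X0 Y0) I.
have comb s t : s *: (a *: x + b *: y) + t *: (c *: x + d *: y) =
    (s * a + t * c) *: x + (s * b + t * d) *: y.
  by rewrite !scalerDr !scalerA addrACA -!scalerDl.
have [|d0 _] := I d (- b).
  rewrite comb (mulrC d a) mulNr D mulNr (mulrC d b) subrr.
  by rewrite !scale0r addr0.
have [|c0 _] := I c (- a).
  rewrite comb (mulrC c a) mulNr subrr mulNr (mulrC c b) -opprB D oppr0.
  by rewrite !scale0r addr0.
by move: Y0; rewrite c0 d0 !scale0r addr0 eqxx.
Qed.

(** The linear form [s b - t a] vanishes exactly at the point [a x + b y], so a
    factorization of the restriction to a line lists the points of the section.
    In the basis given by a point [X] of the line and a second vector, each factor
    is affine in the parameter and has order 1 at [X] if it vanishes there. *)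
Lemma line_cut_split x y k a1 b1 a2 b2 a3 b3 : indep x y -> k != 0 ->
  a1 *: x + b1 *: y != 0 -> a2 *: x + b2 *: y != 0 -> a3 *: x + b3 *: y != 0 ->
  (forall s t, cub (s *: x + t *: y) =
     k * (s * b1 - t * a1) * (s * b2 - t * a2) * (s * b3 - t * a3)) ->
  line_cut F (line_span x y) (ppoint (a1 *: x + b1 *: y)) (ppoint (a2 *: x + b2 *: y))
    (ppoint (a3 *: x + b3 *: y)).
Proof.
move=> xy k0 p1 p2 p3 H.
have onL a b : a *: x + b *: y != 0 ->
  on_line (line_span x y) (ppoint (a *: x + b *: y)).
  by move=> p0; apply/on_line_ppoint => //; apply/sub_line_span; exists a, b.
split; [exact: onL..|] => X y' /andP[XyL LXy].
have XyI : indep (hcoord X) y'.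
  apply/row_free_line_span; move: (row_free_line_span x y) => [_ /(_ xy)].
  rewrite /row_free => /eqP rk; apply/eqP/anti_leq; rewrite rank_leq_row -{1}rk.
  exact: mxrankS.
move: XyL; rewrite line_span_sub => /andP[/sub_line_span[al [be hX]] /sub_line_span[ga [de y'E]]].
have D : al * de - be * ga != 0.
  apply/negP => /eqP D0; move: XyI; rewrite hX y'E.
  have /(ppoint_eq_det xy)h := D0.
  by move=> XyI; apply: (ppoint_indep XyI); apply: h;
    [exact: indep_neq0l XyI|exact: indep_neq0r XyI].
have -> : line_section F (hcoord X) y' =
   k%:P * ((al * b1 - be * a1)%:P + (ga * b1 - de * a1) *: 'X)
   * ((al * b2 - be * a2)%:P + (ga * b2 - de * a2) *: 'X)
   * ((al * b3 - be * a3)%:P + (ga * b3 - de * a3) *: 'X).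
  apply: poly_ext => t; rewrite (line_section_horner pT).
  rewrite !(hornerM, hornerD, hornerZ, hornerC, hornerX).
  have -> : hcoord X + t *: y' = (al + t * ga) *: x + (be + t * de) *: y.
    by rewrite hX y'E scalerDr !scalerA addrACA -!scalerDl.
  by rewrite H; ring.
have X0 : al *: x + be *: y != 0 by rewrite -hX hcoord_neq0.
have nz a b : a *: x + b *: y != 0 ->
  (al * b - be * a != 0) || (ga * b - de * a != 0).
  move=> p0; apply: contraNT p0; rewrite negb_or !negbK => /andP[/eqP e1 /eqP e2].
  have a0 : a * (al * de - be * ga) = ga * (al * b - be * a) - al * (ga * b - de * a) by ring.
  have b0 : b * (al * de - be * ga) = de * (al * b - be * a) - be * (ga * b - de * a) by ring.
  move: a0 b0; rewrite e1 e2 !mulr0 subr0 => /eqP;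
    rewrite mulf_eq0 (negPf D) orbF => /eqP->.
  by move=> /eqP; rewrite mulf_eq0 (negPf D) orbF => /eqP->; rewrite !scale0r addr0.
have fac a b : a *: x + b *: y != 0 ->
   mup 0 ((al * b - be * a)%:P + (ga * b - de * a) *: 'X) = (ppoint (a *: x + b *: y) == X).
  move=> p0; rewrite mup_affine ?nz//; congr (nat_of_bool _).
  apply/eqP/eqP => [/(ppoint_eq_det xy X0 p0)e|e].
    by rewrite -e -hX hcoordK.
  by apply/(ppoint_eq_det xy X0 p0); rewrite e -hX hcoordK.
have fac0 a b : a *: x + b *: y != 0 ->
  (al * b - be * a)%:P + (ga * b - de * a) *: 'X != 0.
  move=> p0; apply/eqP => e; have := nz _ _ p0.
  have := congr1 (horner^~ 1) e; have := congr1 (horner^~ 0) e.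
  rewrite !(hornerD, hornerZ, hornerC, hornerX) mulr0 addr0 mulr1 => ->.
  by rewrite add0r => ->; rewrite eqxx.
rewrite !mupM ?mulf_neq0 ?polyC_eq0 ?fac0// !fac// mupNroot ?rootE ?hornerC//=.
by rewrite add0n [in RHS]addn0 [in RHS]addnA.
Qed.

End LineCut.

(** * Lines meeting the surface in three points *)

Section LineSums.
Context (R : realType).
Local Notation V := 'rV[R]_4.
Implicit Types (x y z w : V) (L : 'M[R]_(2, 4)).
Context (F : mpoly 4 R) (T : V -> V -> V -> R) (pT : polarization F T).
Local Notation cub x := (T x x x).

Lemma line_cut_eqmx L L' P Q Q' : (L == L')%MS ->
  line_cut F L P Q Q' -> line_cut F L' P Q Q'.
Proof.
move=> /eqmxP LL [lP lQ lQ' H]; 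
split; rewrite /on_line -?LL // => X y /eqmxP Xy; apply: H; apply/eqmxP.
exact: eqmx_trans Xy (eqmx_sym LL).
Qed.

Lemma line_in_eqmx L L' : (L == L')%MS -> line_in F L -> line_in F L'.
Proof. by move=> /eqmxP LL H X; rewrite /on_line -LL => /H. Qed.

(** [line_cut] prescribes the multiplicity of every point of the line. *)
Lemma line_cut_unique L P Q Q' P1 Q1 Q1' : row_free L ->
  line_cut F L P Q Q' -> line_cut F L P1 Q1 Q1' ->
  perm_eq [:: P; Q; Q'] [:: P1; Q1; Q1'].
Proof.
have [x [y ->]] := line_span_of L => /row_free_line_span xy.
move=> [lP lQ lQ' H] [lP1 lQ1 lQ1' H1].
have lin A B C X : on_line (line_span x y) A -> on_line (line_span x y) B ->
    on_line (line_span x y) C -> X \in [:: A; B; C] -> on_line (line_span x y) X.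
  move=> lA lB lC.
  rewrite in_cons => /predU1P[-> //|].
  rewrite in_cons => /predU1P[-> //|].
  rewrite in_cons => /predU1P[-> //|].
  by [].
apply/allP => X.
rewrite mem_cat.
move=> /orP memX.
have lX : on_line (line_span x y) X.
  by case: memX; apply: lin.
have [w Xw wE] := line_span_complete xy (hcoord_neq0 X) lX.
apply/eqP. rewrite -(H X w wE). 
by rewrite -(H1 X w wE).
Qed.

Lemma line_in_span x y : (forall s t, cub (s *: x + t *: y) = 0) ->
  line_in F (line_span x y).
Proof.
move=> H X /sub_line_span[s [t hX]].
by apply/(real_pointsE pT); rewrite hX.
Qed.

Lemma line_in_cubic x y : line_in F (line_span x y) ->
  forall s t, cub (s *: x + t *: y) = 0.
Proof.
move=> H s t; have [->|p0] := eqVneq (s *: x + t *: y) 0; first exact: (tri0l pT).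
apply/(real_points_ppoint pT p0)/H/on_line_ppoint => //.
by apply/sub_line_span; exists s, t.
Qed.

(** The condition on three points that makes their sum a [line_sum]. *)
Definition line_triple (P Q Q' : P3 R) := exists2 L : 'M[R]_(2, 4), row_free L &
      (~ line_in F L /\ line_cut F L P Q Q') \/
      [/\ line_in F L, on_line L P, on_line L Q & on_line L Q'].

(** A vanishing scalar [k] is allowed: the line then lies on the surface, and
    any three of its points will do. *)
Lemma line_triple_split x y k a1 b1 a2 b2 a3 b3 : indep x y ->
  a1 *: x + b1 *: y != 0 -> a2 *: x + b2 *: y != 0 -> a3 *: x + b3 *: y != 0 ->
  (forall s t, cub (s *: x + t *: y) =
     k * (s * b1 - t * a1) * (s * b2 - t * a2) * (s * b3 - t * a3)) ->
  line_triple (ppoint (a1 *: x + b1 *: y)) (ppoint (a2 *: x + b2 *: y))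
    (ppoint (a3 *: x + b3 *: y)).
Proof.
move=> xy p1 p2 p3 H; exists (line_span x y); first exact/row_free_line_span.
have onL a b : a *: x + b *: y != 0 ->
  on_line (line_span x y) (ppoint (a *: x + b *: y)).
  by move=> p0; apply/on_line_ppoint => //; apply/sub_line_span; exists a, b.
have [k0|k0] := eqVneq k 0.
  right; split; [|exact: onL..]; apply: line_in_span => s t.
  by rewrite H k0 !mul0r.
left; split; last exact: (line_cut_split pT xy k0).
move=> /line_in_cubic lin.
have nz a b : a *: x + b *: y != 0 -> b%:P + (- a) *: 'X != 0 :> {poly R}.
  apply: contraNneq => e.
  have := congr1 (horner^~ 1) e; have := congr1 (horner^~ 0) e.
  rewrite !(hornerD, hornerZ, hornerC, hornerX) mulr0 addr0 mulr1 => ->.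
  by rewrite add0r => /eqP; rewrite oppr_eq0 => /eqP ->; rewrite !scale0r addr0.
have : k%:P * (b1%:P + (- a1) *: 'X) * (b2%:P + (- a2) *: 'X) * (b3%:P + (- a3) *: 'X) = 0.
  apply: poly_ext => t; rewrite !(hornerM, hornerD, hornerZ, hornerC, hornerX).
  by rewrite -(lin 1 t) H !mul1r; congr (_ * _ * _ * _); rewrite mulNr mulrC.
by apply/eqP; rewrite !mulf_neq0 ?polyC_eq0 ?nz.
Qed.

(** On a tangent line the restriction is [t^2 (3 s T q w w + t T w w w)], whose
    last factor gives the residual point [y]; it is zero when the line lies on
    the surface. *)
Lemma line_triple_tangent q w : indep q w -> cub q = 0 -> T q q w = 0 ->
  let y := (- cub w) *: q + (3 * T q w w) *: w in
  (y != 0 -> line_triple (ppoint q) (ppoint q) (ppoint y)) /\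
  (y = 0 -> line_triple (ppoint q) (ppoint q) (ppoint q)).
Proof.
move=> qw Fq tq y; have q0 := indep_neq0l qw.
have qE : 1 *: q + 0 *: w = q by rewrite scale1r scale0r addr0.
split=> [y0|y0].
  have := @line_triple_split q w 1 1 0 1 0 (- cub w) (3 * T q w w) qw.
  rewrite qE; apply=> // s t.
  by rewrite (cubic_comb pT) Fq tq; ring.
have := @line_triple_split q w 0 1 0 1 0 1 0 qw; rewrite qE; apply=> // s t.
have [e1 e2] := qw _ _ y0.
move: e1 => /eqP; rewrite oppr_eq0 => /eqP e1.
have e3 : T q w w = 0.
  by apply/eqP; move/eqP: e2; rewrite mulf_eq0 pnatr_eq0.
by rewrite (cubic_comb pT) Fq tq e1 e3; ring.
Qed.

Lemma line_triple_tangent_point q x : indep q x -> cub q = 0 -> cub x = 0 ->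
  T q q x = 0 -> line_triple (ppoint q) (ppoint q) (ppoint x).
Proof.
move=> qx Fq Fx tq.
have qE : 1 *: q + 0 *: x = q by rewrite scale1r scale0r addr0.
have xE : 0 *: q + 1 *: x = x by rewrite scale1r scale0r add0r.
have := @line_triple_split q x (3 * T q x x) 1 0 1 0 0 1 qx.
rewrite qE xE; apply => //; [exact: indep_neq0l qx..|exact: indep_neq0r qx|] => s t.
by rewrite (cubic_comb pT) Fq Fx tq; ring.
Qed.

(** The restriction to a chord is [3 s t (s T a a b + t T a b b)]. *)
Definition third_point a b := T a b b *: a - T a a b *: b.

Lemma line_triple_chord a b : indep a b -> cub a = 0 -> cub b = 0 ->
  third_point a b != 0 -> line_triple (ppoint a) (ppoint b) (ppoint (third_point a b)).
Proof.
move=> ab Fa Fb c0.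
have aE : 1 *: a + 0 *: b = a by rewrite scale1r scale0r addr0.
have bE : 0 *: a + 1 *: b = b by rewrite scale1r scale0r add0r.
have cE : third_point a b = T a b b *: a + (- T a a b) *: b by rewrite scaleNr.
have := @line_triple_split a b 3 1 0 0 1 (T a b b) (- T a a b) ab.
rewrite aE bE -cE; apply => //; [exact: indep_neq0l ab|exact: indep_neq0r ab|] => s t.
by rewrite (cubic_comb pT) Fa Fb; ring.
Qed.

Lemma line_cut_chord a b : indep a b -> cub a = 0 -> cub b = 0 ->
  third_point a b != 0 ->
  line_cut F (line_span a b) (ppoint a) (ppoint b) (ppoint (third_point a b)).
Proof.
move=> ab Fa Fb c0.
have aE : 1 *: a + 0 *: b = a by rewrite scale1r scale0r addr0.
have bE : 0 *: a + 1 *: b = b by rewrite scale1r scale0r add0r.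
have cE : third_point a b = T a b b *: a + (- T a a b) *: b by rewrite scaleNr.
have := @line_cut_split _ F T pT a b 3 1 0 0 1 (T a b b) (- T a a b) ab.
rewrite aE bE -cE; apply => //; [exact: indep_neq0l ab|exact: indep_neq0r ab|] => s t.
by rewrite (cubic_comb pT) Fa Fb; ring.
Qed.

Lemma third_cubic a b : cub a = 0 -> cub b = 0 -> cub (third_point a b) = 0.
Proof.
move=> Fa Fb.
have -> : third_point a b = T a b b *: a + (- T a a b) *: b by rewrite scaleNr.
by rewrite (cubic_comb pT) Fa Fb; ring.
Qed.

Lemma third_eq0 a b : indep a b -> cub a = 0 -> cub b = 0 -> third_point a b = 0 ->
  line_in F (line_span a b).
Proof.
move=> ab Fa Fb; rewrite /third_point -scaleNr => /ab[e1 /eqP];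
  rewrite oppr_eq0 => /eqP e2.
apply: line_in_span => s t; rewrite (cubic_comb pT) Fa Fb e1 e2; ring.
Qed.
End LineSums.

(** * Classes of points and tangent lines *)

Section RealRoots.
Context (R : realType).

(** A real polynomial of odd degree changes sign. *)
Lemma binary_cubic_root (a b c d : R) : exists s t, (s != 0) || (t != 0) /\
  s ^+ 3 * a + 3 * s ^+ 2 * t * b + 3 * s * t ^+ 2 * c + t ^+ 3 * d = 0.
Proof.
wlog a0 : a b c d / 0 < a.
  move=> H; have [a0|a0|a0] := ltgtP a 0; last first.
  - exists 1, 0; rewrite oner_eq0; split=> //; rewrite a0; ring.
  - exact: H.
  have [|s [t [st E]]] := H (- a) (- b) (- c) (- d); first by rewrite oppr_gt0.
  exists s, t; split=> //; apply: oppr_inj; rewrite oppr0 -E; ring.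
pose p : {poly R} := a *: 'X^3 + (3 * b) *: 'X^2 + (3 * c) *: 'X + d%:P.
(* For [`|s| = n], the leading term dominates the other ones. *)
pose m : R := `|3 * b| + `|3 * c| + `|d|.
have pE s : p.[s] = a * s ^+ 3 + 3 * b * s ^+ 2 + 3 * c * s + d.
  by rewrite !(hornerD, hornerZ, hornerC, hornerX, hornerXn).
have m0 : 0 <= m by rewrite /m !addr_ge0.
pose n : R := m / a + 1.
have n1 : 1 <= n by rewrite lerDr divr_ge0// ltW.
have an : a * n = m + a by rewrite /n; field; rewrite gt_eqF.
have small (e : R) : `|e| = n -> `|3 * b * e ^+ 2 + 3 * c * e + d| <= m * n ^+ 2.
  move=> eE; rewrite /m (mulrDl _ `|d|) (mulrDl `|3 * b|).
  have h1 : `|3 * b * e ^+ 2| = `|3 * b| * n ^+ 2 by rewrite normrM normrX eE.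
  have h2 : `|3 * c * e| <= `|3 * c| * n ^+ 2.
    rewrite normrM eE; apply: ler_wpM2l => //; rewrite expr2 ler_peMl//.
    exact: le_trans n1.
  have h3 : `|d| <= `|d| * n ^+ 2 by rewrite ler_peMr// exprn_ege1.
  apply: le_trans (ler_normD _ _) _; apply: lerD => //.
  by apply: le_trans (ler_normD _ _) _; rewrite h1 lerD2l.
have big : m * n ^+ 2 < a * n ^+ 3.
  rewrite (exprS n 2) mulrA an (mulrDl m a) ltrDl mulr_gt0// exprn_gt0//.
  exact: lt_le_trans n1.
have n0 : 0 <= n by exact: le_trans n1.
have [||s _ /eqP] := @poly_ivt _ p (- n) n.
- by rewrite (le_trans _ n0)// oppr_le0.
- have := small n (ger0_norm n0); have := small (- n).
  rewrite normrN ger0_norm// => /(_ erefl);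
    rewrite !pE !ler_norml => /andP[h1 h2] /andP[h3 h4].
  have e3 : (- n) ^+ 3 = - n ^+ 3 by ring.
  rewrite e3; apply/andP; split; lra.
rewrite pE => E; exists s, 1; rewrite oner_neq0 orbT; split=> //.
by rewrite -E; ring.
Qed.
End RealRoots.

Section ClassGroup.
Context (R : realType).
Local Notation V := 'rV[R]_4.
Implicit Types (x y z w : V) (P Q : P3 R).
Context (F : mpoly 4 R) (T : V -> V -> V -> R) (pT : polarization F T).
Local Notation cub x := (T x x x).

Lemma clsD : {morph @cls R F : x y / x + y}.
Proof. exact: raddfD. Qed.

(** Defined on all of P^3 so that classes can be computed on coordinate vectors. *)
Definition point_class P : HS F :=
  if pselect (real_points F P) is left h then
    cls (pt (SigSub (mem_set h) : real_points F)) else 0.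

Lemma point_class_val (P : real_points F) : point_class (val P) = cls (pt P).
Proof.
rewrite /point_class; case: pselect => [h|]; last by case; exact: set_mem (valP P).
by congr (cls (pt _)); apply: val_inj.
Qed.

(** By [line_sum_class] the choice of the line sum is irrelevant. *)
Definition line_class : HS F := cls (xget 0 (@line_sum R F)).

Lemma line_sum_class (D D' : GS F) : line_sum D -> line_sum D' -> cls D = cls D'.
Proof.
have dg D0 : line_sum D0 -> Defs.deg D0 = 3.
  by move=> [P [Q [Q' [-> _]]]]; rewrite /Defs.deg !degD !degU.
move=> lD lD'; apply/eqP; rewrite /cls -Quotient.idealrBE; apply/asboolP; split.
  by move=> A [[A0 AB] lA]; apply: AB; apply: lA.
by rewrite /Defs.deg degB -!/(Defs.deg _) !dg // subrr.
Qed.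

Lemma point_class_triple P Q Q' : real_points F P -> real_points F Q ->
  real_points F Q' ->
  line_triple F P Q Q' -> point_class P + point_class Q + point_class Q' = line_class.
Proof.
move=> SP SQ SQ' [L Lf H].
pose P1 : real_points F := SigSub (mem_set SP).
pose Q1 : real_points F := SigSub (mem_set SQ).
pose Q1' : real_points F := SigSub (mem_set SQ').
have lD : line_sum (pt P1 + pt Q1 + pt Q1').
  by exists P1, Q1, Q1'; split=> //; exists L.
rewrite -[P]/(val P1) -[Q]/(val Q1) -[Q']/(val Q1') !point_class_val -!clsD.
apply: line_sum_class => //.
by apply: xgetPex; eexists; exact: lD.
Qed.
End ClassGroup.

Section TangentClasses.
Context (R : realType).
Local Notation V := 'rV[R]_4.
Implicit Types (x y z w q : V) (P Q : P3 R).
Context (F : mpoly 4 R) (T : V -> V -> V -> R) (pT : polarization F T).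
Local Notation cub x := (T x x x).
Local Notation vclass x := (point_class F (ppoint x)).
Local Notation lcl := (line_class F).

Lemma class_triple x y z : x != 0 -> y != 0 -> z != 0 ->
  cub x = 0 -> cub y = 0 -> cub z = 0 ->
  line_triple F (ppoint x) (ppoint y) (ppoint z) -> vclass x + vclass y + vclass z = lcl.
Proof.
by move=> x0 y0 z0 Fx Fy Fz; apply: point_class_triple; apply/(real_points_ppoint pT).
Qed.

Lemma class_tangent_point q x : indep q x -> cub q = 0 -> cub x = 0 ->
  T q q x = 0 -> vclass q *+ 2 + vclass x = lcl.
Proof.
move=> qx Fq Fx tq; have [q0 x0] := (indep_neq0l qx, indep_neq0r qx).
by apply: class_triple => //; apply: (line_triple_tangent_point pT).
Qed.

(** The residual point of a tangent line; it is [q] itself for a flex tangent. *)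
Lemma class_tangent q w : indep q w -> cub q = 0 -> T q q w = 0 ->
  exists a b, [/\ a *: q + b *: w != 0, cub (a *: q + b *: w) = 0 &
    vclass q *+ 2 + vclass (a *: q + b *: w) = lcl].
Proof.
move=> qw Fq tq; have [h1 h2] := line_triple_tangent pT qw Fq tq.
have q0 := indep_neq0l qw.
have [y0|y0] := eqVneq ((- cub w) *: q + (3 * T q w w) *: w) 0.
  exists 1, 0; rewrite scale1r scale0r addr0; split=> //.
  by apply: class_triple => //; exact: h2.
have Fy : cub ((- cub w) *: q + (3 * T q w w) *: w) = 0.
  by rewrite (cubic_comb pT) Fq tq; ring.
exists (- cub w), (3 * T q w w); split=> //.
by apply: class_triple => //; exact: h1.
Qed.

(** A flex tangent meets the surface at [q] with multiplicity 3. *)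
Lemma class_flex q w : indep q w -> cub q = 0 -> T q q w = 0 -> T q w w = 0 ->
  vclass q *+ 3 = lcl.
Proof.
move=> qw Fq tq tw; have [h1 h2] := line_triple_tangent pT qw Fq tq.
have q0 := indep_neq0l qw; rewrite mulrSr.
move: h1 h2; rewrite tw mulr0 scale0r addr0; have [->|Fw] := eqVneq (cub w) 0.
  rewrite oppr0 scale0r => _ /(_ erefl) h.
  exact: class_triple h.
rewrite ppointZ ?oppr_eq0// scaler_eq0 oppr_eq0 (negPf Fw) (negPf q0).
by move=> /(_ isT) h _; exact: class_triple h.
Qed.

Lemma tri_sum x y z : T x y z = \sum_i z ord0 i * T x y (delta_mx ord0 i).
Proof.
rewrite {1}[z]row_sum_delta.
have t0 : T x y 0 = 0 by rewrite -(scale0r 0) (triZ3 pT) mul0r.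
rewrite (big_morph (T x y) (fun u v => triD3 pT u v x y) t0).
by apply: eq_bigr => i _; rewrite (triZ3 pT).
Qed.

Lemma two_planes_meet (f g : 'cV[R]_4) :
  exists u v : V, [/\ indep u v, u *m f = 0, v *m f = 0, u *m g = 0 & v *m g = 0].
Proof.
pose K := kermx (row_mx f g).
have rK : (1 < \rank K)%N.
  by rewrite mxrank_ker; have := rank_leq_col (row_mx f g);
    case: (\rank _) => [|[|[]]].
pose B := row_base K; pose i0 := Ordinal (ltnW rK); pose i1 := Ordinal rK.
have kill i : row i B *m f = 0 /\ row i B *m g = 0.
  have : row i B *m row_mx f g = 0.
    by apply/sub_kermxP/(submx_trans (row_sub i B)); rewrite eq_row_base.
  by rewrite mul_mx_row -row_mx0 => /eq_row_mx.
have [f0 g0] := kill i0; have [f1 g1] := kill i1.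
exists (row i0 B), (row i1 B); split=> // s t.
rewrite !rowE !scalemxAl -mulmxDl => e.
have e1 : s *: delta_mx 0 i0 + t *: delta_mx 0 i1 = 0 :> 'rV[R]_(\rank K).
  by apply: (row_free_inj (row_base_free K)); rewrite /= e mul0mx.
have := congr1 (fun M : 'rV_(\rank K) => M 0 i0) e1.
have := congr1 (fun M : 'rV_(\rank K) => M 0 i1) e1.
by rewrite !mxE !eqxx /= !mulr1 !mulr0 add0r addr0 => -> ->.
Qed.

Lemma tangent_planes_meet q q' : exists u v,
  [/\ indep u v, T q q u = 0, T q q v = 0, T q' q' u = 0 & T q' q' v = 0].
Proof.
pose col p : 'cV[R]_4 := \col_i T p p (delta_mx ord0 i).
have colE p z : T p p z = (z *m col p) ord0 ord0.
  by rewrite tri_sum mxE; apply: eq_bigr => i _; rewrite mxE.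
have [u [v [uv e1 e2 e3 e4]]] := two_planes_meet (col q) (col q').
by exists u, v; split=> //; rewrite colE ?e1 ?e2 ?e3 ?e4 mxE.
Qed.

Lemma tangent_direction q q' : q != 0 ->
  exists w, [/\ indep q w, T q q w = 0 & T q' q' w = 0].
Proof.
move=> q0; have [u [v [uv tu tv tu' tv']]] := tangent_planes_meet q q'.
have [qu|/(not_indep q0)[k uE]] := pselect (indep q u); first by exists u.
have [qv|/(not_indep q0)[l vE]] := pselect (indep q v); first by exists v.
have k0 : k != 0 by have := indep_neq0l uv; rewrite uE scaler_eq0 negb_or => /andP[].
have [] := uv l (- k); first by rewrite uE vE !scalerA mulrC mulNr scaleNr subrr.
by move=> _ /eqP; rewrite oppr_eq0 (negPf k0).
Qed.

(** The line common to the tangent planes at [q] and [q'] meets the surface at a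
    real point [y], and [2 q + y] and [2 q' + y] are both line sections.  The point
    [y] may be [q] when [q] lies on both planes; the line is then tangent at [q],
    and its residual point is used instead. *)
Lemma class_double q q' : q != 0 -> q' != 0 -> cub q = 0 -> cub q' = 0 ->
  vclass q *+ 2 = vclass q' *+ 2.
Proof.
move=> q0 q'0 Fq Fq'; have [->//|qq'] := eqVneq (ppoint q) (ppoint q').
have {qq'} qq' : indep q q' by apply: indep_ppoint => //; apply/eqP.
(* The case of a point [p] lying on the tangent plane at [p'] as well. *)
have side p p' : indep p p' -> cub p = 0 -> cub p' = 0 ->
   T p' p' p = 0 -> vclass p *+ 2 = vclass p' *+ 2.
  move=> pp' Fp Fp' tp'p.
  have E' : vclass p' *+ 2 + vclass p = lcl by apply: class_tangent_point => //;
    apply: indepC.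
  have p0 := indep_neq0l pp'; have p'0 := indep_neq0r pp'.
  have [w [pw tw tw']] := tangent_direction p' p0.
  have [a [b [y0 Fy E]]] := class_tangent pw Fp tw.
  set y := a *: p + b *: w in y0 Fy E.
  have ty' : T p' p' y = 0 by rewrite /y !(triE pT) tp'p tw' !mulr0 addr0.
  have ty : T p p y = 0 by rewrite /y !(triE pT) Fp tw !mulr0 addr0.
  have [yp'|/eqP yp'] := eqVneq (ppoint y) (ppoint p').
    (* The line [pp'] is tangent at both ends, hence lies on the surface. *)
    have [k k0 yE] := ppoint_colinear y0 p'0 yp'.
    have tpp' : T p p p' = 0.
      by apply/eqP; move/eqP: ty; rewrite yE (triZ3 pT) mulf_eq0 (negPf k0).
    have tpp'p' : T p p' p' = 0 by rewrite -(tri_sym pT p p').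
    have e1 := class_flex pp' Fp tpp' tpp'p'.
    have e2 := class_tangent_point pp' Fp Fp' tpp'.
    have kpp' : vclass p = vclass p' by move: e1; rewrite mulrSr -e2 => /addrI.
    by rewrite kpp'.
  have p'y : indep p' y by apply: indep_ppoint => // /esym.
  have := class_tangent_point p'y Fp' Fy ty'; rewrite -E => /addIr.
  by move=> ->.
have [t1|t1] := eqVneq (T q' q' q) 0; first exact: side.
have [t2|t2] := eqVneq (T q q q') 0.
  by apply/esym/side => //; exact: indepC.
have [u [v [uv tu tv tu' tv']]] := tangent_planes_meet q q'.
have [s [t [st E]]] := binary_cubic_root (cub u) (T u u v) (T u v v) (cub v).
pose y := s *: u + t *: v.
have y0 : y != 0 by apply/eqP => /uv[s0 t0]; move: st; rewrite s0 t0 eqxx.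
have Fy : cub y = 0 by rewrite /y (cubic_comb pT) -E; ring.
have ty : T q q y = 0 by rewrite /y !(triE pT) tu tv !mulr0 addr0.
have ty' : T q' q' y = 0 by rewrite /y !(triE pT) tu' tv' !mulr0 addr0.
have qy : indep q y.
  apply: contrapT => /(not_indep q0)[k yE].
  have k0 : k != 0 by apply: contraNneq y0 => k0; rewrite yE k0 scale0r.
  by move: t1; rewrite -(mulrI_eq0 _ (mulfI k0)) -(triZ3 pT) -yE ty' eqxx.
have q'y : indep q' y.
  apply: contrapT => /(not_indep q'0)[k yE].
  have k0 : k != 0 by apply: contraNneq y0 => k0; rewrite yE k0 scale0r.
  by move: t2; rewrite -(mulrI_eq0 _ (mulfI k0)) -(triZ3 pT) -yE ty eqxx.
have e1 := class_tangent_point qy Fq Fy ty;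
  have e2 := class_tangent_point q'y Fq' Fy ty'.
by move: e1; rewrite -e2 => /addIr.
Qed.
End TangentClasses.

(** * Connectedness and compactness *)

Section Tools.

Lemma connected_closed_split (X : topologicalType) (A C1 C2 : set X) :
  connected A -> closed C1 -> closed C2 -> A `<=` C1 `|` C2 ->
  (forall x, A x -> C1 x -> ~ C2 x) -> (A `&` C1) !=set0 -> A `<=` C1.
Proof.
move=> cA c1 c2 cov dis ne; suff <- : A `&` C1 = A by move=> x [].
apply: cA => //; last by exists C1.
exists (~` C2); first by rewrite openC.
apply/seteqP; split=> x [Ax Cx]; split=> //; first exact: dis.
by case: (cov x Ax).
Qed.

(** The projection along a compact set is a closed map. *)
Lemma compact_tube (X Y : topologicalType) (K : set X) (C : set (X * Y)) (y0 : Y) :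
  compact K -> closed C -> (forall x, K x -> ~ C (x, y0)) ->
  \forall y \near y0, forall x, K x -> ~ C (x, y).
Proof.
move=> /compact_near_coveringP cK cC h.
apply: (cK Y (nbhs y0) (fun y x => ~ C (x, y))) => x Kx.
have : nbhs (x, y0) (~` C) by apply: open_nbhs_nbhs; split; [rewrite openC|exact: h].
by move=> [[U W] /= UW sub]; exists (U, W) => // -[x' y'] ?; exact: sub.
Qed.

Lemma closed_preimage (X Y : topologicalType) (f : X -> Y) (A : set Y) :
  continuous f -> closed A -> closed (f @^-1` A).
Proof. by move=> /continuous_closedP; apply. Qed.

Context (R : realType).

Lemma closed_eq0 (X : topologicalType) (f : X -> R) : continuous f ->
  closed [set x | f x = 0].
Proof. by move=> cf; exact: (closed_preimage cf (@closed_eq _ 0)). Qed.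

Lemma closed_le0 (X : topologicalType) (f : X -> R) : continuous f ->
  closed [set x | f x <= 0].
Proof. by move=> cf; exact: (closed_preimage cf (@closed_le _ 0)). Qed.

Lemma closed_ge0 (X : topologicalType) (f : X -> R) : continuous f ->
  closed [set x | 0 <= f x].
Proof. by move=> cf; exact: (closed_preimage cf (@closed_ge _ 0)). Qed.

Lemma open_gt0 (X : topologicalType) (f : X -> R) : continuous f ->
  open [set x | 0 < f x].
Proof. by move=> /continuousP cf; exact: (cf _ (@open_gt _ 0)). Qed.

Lemma open_lt0 (X : topologicalType) (f : X -> R) : continuous f ->
  open [set x | f x < 0].
Proof. by move=> /continuousP cf; exact: (cf _ (@open_lt _ 0)). Qed.

Lemma sphere_compact n : compact [set v : 'rV[R]_n | `|v| = 1].
Proof.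
apply: bounded_closed_compact.
  by exists 1; split=> // M M1 v /= ->; exact: ltW.
rewrite (_ : mkset _ = (fun v : 'rV[R]_n => `|v|) @^-1` [set 1])//.
by apply: (closed_preimage (@norm_continuous _ _)); exact: closed_eq.
Qed.

Lemma segment_split (C1 C2 : set R) : closed C1 -> closed C2 ->
  (forall s, 0 <= s <= 1 -> C1 s \/ C2 s) ->
  (forall s, 0 <= s <= 1 -> C1 s -> ~ C2 s) -> C1 0 -> C1 1.
Proof.
move=> c1 c2 cov dis h0.
apply: (connected_closed_split (@segment_connected R 0 1) c1 c2).
- by move=> s; rewrite /= in_itv /=; exact: cov.
- by move=> s; rewrite /= in_itv /=; exact: dis.
- by exists 0; split=> //; rewrite /= in_itv /= lexx ler01.
- by rewrite /= in_itv /= lexx ler01.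
Qed.

(** Connectedness in P^3, tested on homogeneous coordinates. *)
Lemma connected_cone_split (A : set (P3 R)) (C1 C2 : set 'rV[R]_4) :
  connected A -> homogeneous C1 -> homogeneous C2 -> closed C1 -> closed C2 ->
  (forall x, x != 0 -> A (ppoint x) -> C1 x \/ C2 x) ->
  (forall x, x != 0 -> A (ppoint x) -> C1 x -> ~ C2 x) ->
  (exists x, [/\ x != 0, A (ppoint x) & C1 x]) ->
  forall x, x != 0 -> A (ppoint x) -> C1 x.
Proof.
move=> cA h1 h2 c1 c2 cov dis [x0 [x00 Ax0 C1x0]].
have sub : A `<=` [set P | C1 (hcoord P)].
  apply: (connected_closed_split cA (closed_hcoord h1 c1) (closed_hcoord h2 c2)).
  - by move=> P AP /=; apply: cov; rewrite ?hcoord_neq0 ?hcoordK.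
  - by move=> P AP /=; apply: dis; rewrite ?hcoord_neq0 ?hcoordK.
  - by exists (ppoint x0); split=> //; apply/homogeneous_ppoint.
by move=> x x0n Ax; apply/(homogeneous_ppoint h1 x0n); apply: sub.
Qed.

Lemma cone_ppoint (A : set (P3 R)) (x : 'rV[R]_4) : x != 0 ->
  cone A x <-> A (ppoint x).
Proof.
by move=> x0; split=> [[/eqP|//]|]; [rewrite (negPf x0)|right].
Qed.

Lemma homogeneous_cone (A : set (P3 R)) : homogeneous (cone A).
Proof.
move=> k x k0; have [->|x0] := eqVneq x 0; first by rewrite scaler0.
by rewrite !cone_ppoint ?scaler_eq0 ?negb_or ?k0// ppointZ.
Qed.
End Tools.

Section ContinuousAt.
Context (R : realType) (X : topologicalType) (W : normedModType R) (s : X).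
Implicit Types (f g : X -> W) (k : X -> R).

Lemma continuous_at_add f g : continuous_at s f -> continuous_at s g ->
  continuous_at s (fun x => f x + g x).
Proof. exact: cvgD. Qed.

Lemma continuous_at_opp f : continuous_at s f -> continuous_at s (fun x => - f x).
Proof. exact: cvgN. Qed.

Lemma continuous_at_scale k f : continuous_at s k -> continuous_at s f ->
  continuous_at s (fun x => k x *: f x).
Proof. exact: cvgZ. Qed.

Lemma continuous_at_mul k k' : continuous_at s k -> continuous_at s k' ->
  continuous_at s (fun x => k x * k' x).
Proof. exact: cvgM. Qed.

Lemma continuous_at_sqr k : continuous_at s k -> continuous_at s (fun x => k x ^+ 2).
Proof. by move=> ck; apply: continuous_at_mul. Qed.
End ContinuousAt.

Lemma continuous_at_tri (R : realType) (F : mpoly 4 R) T (pT : polarization F T)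
    (X : topologicalType) (f g h : X -> 'rV[R]_4) (s : X) :
  continuous_at s f -> continuous_at s g -> continuous_at s h ->
  continuous_at s (fun x => T (f x) (g x) (h x)).
Proof. exact: (pol_continuous pT). Qed.

Lemma continuous_at_tri3 (R : realType) (F : mpoly 4 R) T (pT : polarization F T) x y z :
  continuous_at z (T x y).
Proof.
by apply: (continuous_at_tri pT (f := cst x) (g := cst y) (h := id));
  [exact: cst_continuous..|exact: cvg_id].
Qed.

(** Proves the continuity of expressions built from sums, products and the
    trilinear form. *)
Ltac poly_cont pT := try (let z := fresh "z" in intro z); repeat first
  [ match goal with |- continuous_at _ (fun x => - (@?f x)) => apply: continuous_at_opp end
  | match goal with |- continuous_at _ (fun x => @?f x + @?g x) => apply: continuous_at_add end
  | match goal with |- continuous_at _ (fun x => @?f x *: @?g x) => apply: continuous_at_scale end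
  | match goal with |- continuous_at _ (fun x => @?f x ^+ 2) => apply: continuous_at_sqr end
  | match goal with |- continuous_at _ (fun x => @?f x * @?g x) => apply: continuous_at_mul end
  | match goal with |- continuous_at _ (fun x => _ (@?f x) (@?g x) (@?h x)) =>
      apply: (continuous_at_tri pT (f := f) (g := g) (h := h)) end
  | match goal with |- continuous_at _ (fun x => ?c) => first [exact: cst_continuous | exact: cvg_cst] end
  | assumption | exact: cvg_id | exact: cvg_fst | exact: cvg_snd | exact: opp_continuous
  | exact: (continuous_at_tri3 pT) ].

(** * A connected surface *)

Section OneComponent.
Context (R : realType).
Local Notation V := 'rV[R]_4.
Implicit Types (x y z w q : V) (P Q : P3 R).
Context (F : mpoly 4 R) (T : V -> V -> V -> R) (pT : polarization F T).
Local Notation cub x := (T x x x).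
Local Notation vclass x := (point_class F (ppoint x)).
Local Notation lcl := (line_class F).

(** The class shared by all points that lie on the tangent plane at another point. *)
Definition base_class x := forall q, q != 0 -> cub q = 0 -> vclass q *+ 2 + vclass x = lcl.

Lemma base_class_tangent q x : indep q x -> cub q = 0 -> cub x = 0 ->
  T q q x = 0 -> base_class x.
Proof.
move=> qx Fq Fx tq q' q'0 Fq'; rewrite -(class_double pT (indep_neq0l qx) q'0)//.
exact: (class_tangent_point pT).
Qed.

Lemma base_class_flex q w : indep q w -> cub q = 0 -> T q q w = 0 -> T q w w = 0 ->
  base_class q.
Proof.
move=> qw Fq tq tw q' q'0 Fq';
  rewrite -(class_double pT (indep_neq0l qw) q'0)// -mulrSr.
exact: (class_flex pT) tw.
Qed.

(** The form [T x v v] on the tangent plane is the second fundamental form.  On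
    the line of directions [w + s w0] it is a quadratic polynomial in [s] without
    real root. *)
Lemma definite_tangent x w0 w : cub x = 0 -> indep x w0 -> T x x w0 = 0 ->
  (forall v, indep x v -> T x x v = 0 -> T x v v != 0) ->
  indep x w -> T x x w = 0 -> 0 < T x w0 w0 * T x w w.
Proof.
move=> Fx xw0 t0 H xw t.
have x0 := indep_neq0l xw.
set a := T x w0 w0; set c := T x w w; set b := T x w w0.
have a0 : a != 0 by exact: H.
have E s : T x (w + s *: w0) (w + s *: w0) = a * s ^+ 2 + 2 * b * s + c.
  by rewrite !(triE pT) (polC23 pT x w0 w) /a /b /c; ring.
(* If [w] and [w0] give the same tangent line, both values differ by a square. *)
have Es s k : w + s *: w0 = k *: x -> 0 < a * c.
  move=> e; have we : w = k *: x + (- s) *: w0 by rewrite -e scaleNr addrK.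
  have s0 : s != 0.
    apply/eqP => s0; have [|_ /eqP] := xw k (- 1).
      by rewrite we s0 oppr0 scale0r addr0 scaleN1r subrr.
    by rewrite oppr_eq0 oner_eq0.
  have -> : c = s ^+ 2 * a.
    rewrite /c we !(triE pT) (polC23 pT x w0 x) t0 Fx /a; ring.
  by rewrite mulrCA mulr_gt0 ?exprn_even_gt0// -expr2 exprn_even_gt0.
have nz s : a * c <= 0 -> a * s ^+ 2 + 2 * b * s + c != 0.
  move=> ac; rewrite -E; apply: H; last by rewrite !(triE pT) t t0 mulr0 addr0.
  apply: contrapT => /(not_indep x0)[k] /Es; by rewrite ltNge ac.
rewrite ltNge; apply/negP => ac.
pose r := Num.sqrt (b ^+ 2 - a * c).
have r2 : r ^+ 2 = b ^+ 2 - a * c.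
  by rewrite sqr_sqrtr// subr_ge0 (le_trans ac)// sqr_ge0.
have /negP := nz ((- b + r) / a) ac; apply; apply/eqP.
rewrite (_ : _ + c = (r ^+ 2 - (b ^+ 2 - a * c)) / a);
  first by rewrite r2 subrr mul0r.
by field.
Qed.

(** For [y = x + w] on the surface, [T x x w ~ - T x w w], so that
    [T x y y = 2 T x x w + T x w w ~ - T x w w]: near [x] its sign is opposite to
    that of the definite form [T x w w].
    Writing [w = r v] with [v] on a sphere complementary to [x], the estimate
    holds for small [r] by compactness. *)
Lemma sheet_neighborhood x sg : x != 0 -> cub x = 0 ->
  (forall v, indep x v -> T x x v = 0 -> 0 < sg * T x v v) ->
  exists N : set V, [/\ homogeneous N, open N, N x &
    forall y, N y -> cub y = 0 -> sg * T x y y <= 0].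
Proof.
move=> x0 Fx Hdef.
have [i xi] : exists i, x ord0 i != 0.
  apply: contrapT => /forallNP h; move: x0; apply/negP/negPn/eqP/rowP => i.
  by rewrite mxE; apply/eqP/negPn/negP/h.
(* A vector [y] is decomposed as [phi y *: x + p y], where [p y] has no [i]-th
   coordinate. *)
pose phi (y : V) : R := y ord0 i / x ord0 i; pose p (y : V) : V := y - phi y *: x.
have c_phi : continuous phi.
  by move=> y; apply: continuous_at_mul;
    [exact: (@coord_continuous R 1 4 ord0 i y)|exact: cst_continuous].
have c_p : continuous p.
  move=> y; apply: continuous_at_add; first exact: cvg_id.
  apply: continuous_at_opp; apply: continuous_at_scale;
    [exact: c_phi|exact: cst_continuous].
have pi0 y : p y ord0 i = 0 by rewrite /p /phi !mxE divfK// subrr.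
pose K : set V := [set v : V | `|v| = 1] `&` [set v : V | v ord0 i = 0].
have cK : compact K.
  apply: compact_closedI; first exact: sphere_compact.
  exact: (closed_eq0 (@coord_continuous R 1 4 ord0 i)).
(* The conditions on [x + r v], divided by [3 r] and by [r ^+ 2]. *)
pose C : set (V * R) :=
  [set q | T x x q.1 + q.2 * T x q.1 q.1 + q.2 ^+ 2 * (cub q.1 / 3) = 0] `&`
  [set q | sg * (T x q.1 q.1 + q.2 * (2 * cub q.1 / 3)) <= 0].
have cC : closed C.
  by apply: closedI; [apply: closed_eq0|apply: closed_le0]; poly_cont pT.
have CK0 v : K v -> ~ C (v, 0).
  move=> [/= v1 vi] [/=]; rewrite expr2 !mul0r !addr0 => tv.
  apply/negP; rewrite -ltNge; apply: Hdef => //.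
  move=> s t e; have := congr1 (fun u : V => u ord0 i) e.
  rewrite !mxE vi mulr0 addr0 => /eqP; rewrite mulf_eq0 (negPf xi) orbF => /eqP s0.
  split=> //; move: e; rewrite s0 scale0r add0r => /eqP.
  by rewrite scaler_eq0 => /orP[/eqP//|/eqP v0]; move: v1; rewrite v0 normr0 => /eqP;
    rewrite eq_sym oner_eq0.
have /nbhs_ballP[d /= d0 Hd] := compact_tube cK cC CK0.
exists [set y | `|p y| < d * `|phi y|]; split.
- move=> k y k0 /=.
  have -> : phi (k *: y) = k * phi y by rewrite /phi mxE mulrA.
  have -> : p (k *: y) = k *: p y.
    by rewrite /p /phi mxE scalerBr scalerA mulrA.
  by move=> yN; rewrite normrZ (normrM k) (mulrCA d) ltr_pM2l ?normr_gt0.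
- rewrite (_ : mkset _ = [set y | 0 < d * `|phi y| - `|p y|]); last first.
    by apply/seteqP; split=> y /=; rewrite subr_gt0.
  apply: open_gt0 => y; apply: continuous_at_add.
    apply: continuous_at_mul; first exact: cst_continuous.
    exact: (continuous_comp (c_phi y) (@norm_continuous _ _ _)).
  apply: continuous_at_opp.
  exact: (continuous_comp (c_p y) (@norm_continuous _ _ _)).
- rewrite /= /p /phi divff// scale1r subrr normr0 normr1 mulr1 //.
move=> y /= yN Fy; rewrite leNgt; apply/negP => pos.
have c0 : phi y != 0.
  by apply: contraTneq yN => ->; rewrite normr0 mulr0 -leNgt.
pose w := (phi y)^-1 *: p y.
have yE : y = phi y *: (x + w).
  by rewrite /w scalerDr scalerA mulfV// scale1r /p addrC subrK.
have wd : `|w| < d.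
  by rewrite /w normrZ normfV mulrC ltr_pdivrMr// normr_gt0.
have Fw : cub (x + w) = 0.
  by apply/eqP; move/eqP: Fy;
    rewrite {1 2 3}yE (cubicZ pT) mulf_eq0 expf_eq0 (negPf c0).
have pos' : 0 < sg * T x (x + w) (x + w).
  move: pos; rewrite yE (triZ2 pT) (triZ3 pT) (mulrA (phi y)) -expr2 mulrCA.
  by rewrite pmulr_rgt0// exprn_even_gt0.
have [w0|w0] := eqVneq w 0; first by move: pos'; rewrite w0 addr0 Fx mulr0 ltxx.
have r0 : 0 < `|w| by rewrite normr_gt0.
pose v := `|w|^-1 *: w.
have wE : w = `|w| *: v by rewrite /v scalerA mulfV ?scale1r// gt_eqF.
have Kv : K v.
  split=> /=; first by rewrite /v normrZ normfV normr_id mulVf// gt_eqF.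
  by rewrite /v /w scalerA [LHS]mxE pi0 mulr0.
have := Hd `|w|; rewrite /ball /= sub0r normrN normr_id => /(_ wd v Kv); apply.
move: Fw pos'; set r := `|w| in r0 wE *; clearbody r v; rewrite wE.
rewrite !(triE pT) !(tri_sym pT x v) Fx => e1 e2.
set l := T x x v in e1 e2 *; set q := T x v v in e1 e2 *; set c := cub v in e1 e2 *.
have e3 : l + r * q + r ^+ 2 * (c / 3) = 0.
  apply: (mulfI (lt0r_neq0 r0)); rewrite mulr0.
  by apply: (@mulfI _ 3) => //; rewrite mulr0 -e1; field.
split=> //=; apply: ltW; rewrite -(pmulr_rlt0 _ (exprn_gt0 2 r0)) -oppr_gt0.
suff <- : sg * (0 + (r * l + r * (l + r * q))) = - (r ^+ 2 * (sg * (q + r * (2 * c / 3)))).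
  by move: e2; congr (0 < _); ring.
have -> : l = - (r * q + r ^+ 2 * (c / 3)) by apply/eqP; rewrite -addr_eq0 addrA e3.
by field.
Qed.

(** If [x] were not of the base class, [T x y y] would vanish on the surface only at
    [x], and its sign would split the surface into two sheets, both nonempty: the
    residual point of a tangent line at [x] is on the sheet that avoids [x]. *)
Lemma connected_base_class x : connected (real_points F) -> x != 0 -> cub x = 0 ->
  base_class x.
Proof.
move=> cS x0 Fx; apply: contrapT => nb.
have H1 y : indep x y -> cub y = 0 -> T x y y != 0.
  move=> xy Fy; apply/eqP => t; apply: nb;
    apply: (base_class_tangent (indepC xy)) => //.
  by rewrite (tri_sym pT x y).
have H2 v : indep x v -> T x x v = 0 -> T x v v != 0.
  by move=> xv t; apply/eqP => t'; apply: nb; exact: base_class_flex t t'.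
have [w0 [xw0 t0 _]] := tangent_direction pT x x0.
pose sg := T x w0 w0.
have sg0 : sg != 0 by exact: H2.
have Hdef v : indep x v -> T x x v = 0 -> 0 < sg * T x v v.
  exact: definite_tangent.
have [N [hN oN Nx HN]] := sheet_neighborhood x0 Fx Hdef.
(* The residual point of the tangent line of direction [w0]. *)
pose y0 := (- cub w0) *: x + (3 * sg) *: w0.
have y00 : y0 != 0.
  by apply/eqP => /xw0[_ /eqP]; rewrite mulf_eq0 (negPf sg0) pnatr_eq0.
have Fy0 : cub y0 = 0 by rewrite /y0 (cubic_comb pT) Fx t0 -/sg; ring.
have ty0 : 0 < sg * T x y0 y0.
  rewrite /y0 !(triE pT) (polC23 pT x w0 x) Fx t0 -/sg.
  rewrite (_ : _ * _ = (3 * sg ^+ 2) ^+ 2); last by ring.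
  by rewrite exprn_even_gt0//= mulf_neq0// ?expf_neq0// pnatr_eq0.
(* The two sheets; removing [N] makes the first one closed. *)
pose C1 : set V := ~` N `&` [set y | 0 <= sg * T x y y].
pose C2 : set V := [set y | sg * T x y y <= 0].
have scal k y : sg * T x (k *: y) (k *: y) = k ^+ 2 * (sg * T x y y).
  by rewrite !(triE pT); ring.
have [] : C1 x; last by move=> /(_ Nx).
apply: (@connected_cone_split R (real_points F) C1 C2) => //.
- move=> k y k0 [nNy ty]; split; last by rewrite /= scal mulr_ge0// exprn_even_ge0.
  by move=> /(hN k^-1); rewrite scalerK// invr_eq0 => /(_ k0).
- move=> k y k0; rewrite /C2 /= scal => ty.
  by rewrite mulr_ge0_le0// exprn_even_ge0.
- apply: closedI; first by rewrite closedC.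
  by apply: closed_ge0; poly_cont pT.
- by apply: closed_le0; poly_cont pT.
- move=> y yn0 /(real_points_ppoint pT yn0) Fy; have [ty|ty] := leP (sg * T x y y) 0;
    first by right.
  by left; split; [move=> /HN/(_ Fy); rewrite leNgt ty|exact: ltW].
- move=> y yn0 /(real_points_ppoint pT yn0) Fy [nNy /= ty] /= ty'.
  have : sg * T x y y == 0 by rewrite eq_le ty' ty.
  rewrite mulf_eq0 (negPf sg0) /=; apply/negP/H1 => //.
  apply: contrapT => /(not_indep x0)[k yE]; apply: nNy; rewrite yE; apply: hN => //.
  by apply: contraNneq yn0 => k0; rewrite yE k0 scale0r.
- exists y0; split=> //; first exact/(real_points_ppoint pT).
  by split; [move=> /HN/(_ Fy0); rewrite leNgt ty0|exact: ltW].
- exact/(real_points_ppoint pT).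
Qed.
End OneComponent.

(** * The third point of a chord between two components *)

Section TwoComponents.
Context (R : realType).
Local Notation V := 'rV[R]_4.
Implicit Types (x y z w q a b u : V) (P Q : P3 R) (A B : set (P3 R)).
Context (F : mpoly 4 R) (T : V -> V -> V -> R) (pT : polarization F T).
Local Notation cub x := (T x x x).
Local Notation vclass x := (point_class F (ppoint x)).
Local Notation lcl := (line_class F).
Local Notation third := (third_point T).

Record splitting A B : Prop := Splitting {
  split_connl : connected A; split_connr : connected B;
  split_closedl : closed A; split_closedr : closed B;
  split_cover : real_points F = A `|` B;
  split_disjoint : forall P, A P -> ~ B P;
  split_nel : A !=set0; split_ner : B !=set0 }.

Lemma splittingC A B : splitting A B -> splitting B A.
Proof.
case=> cA cB clA clB AB dis nA nB; split=> //; first by rewrite setUC.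
by move=> P BP /dis.
Qed.

Lemma split_mem A B P : splitting A B -> real_points F P -> A P \/ B P.
Proof. by move=> sp; rewrite (split_cover sp). Qed.

Lemma split_nonzero A : A !=set0 -> exists x, x != 0 /\ A (ppoint x).
Proof. by case=> P AP; exists (hcoord P); rewrite hcoord_neq0 hcoordK. Qed.

Lemma splitl_cubic A B x : splitting A B -> x != 0 -> A (ppoint x) -> cub x = 0.
Proof.
by move=> sp x0 Ax; apply/(real_points_ppoint pT x0); rewrite (split_cover sp); left.
Qed.

Lemma splitr_cubic A B x : splitting A B -> x != 0 -> B (ppoint x) -> cub x = 0.
Proof. by move=> /splittingC; exact: splitl_cubic. Qed.

Lemma split_or A B x : splitting A B -> x != 0 -> cub x = 0 ->
  A (ppoint x) \/ B (ppoint x).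
Proof. by move=> sp x0 /(real_points_ppoint pT x0); rewrite (split_cover sp). Qed.

Lemma split_indep A B a b : splitting A B -> a != 0 -> b != 0 ->
  A (ppoint a) -> B (ppoint b) -> indep a b.
Proof.
by move=> sp a0 b0 Aa Bb; apply: indep_ppoint => // e; apply: (split_disjoint sp Aa);
  rewrite e.
Qed.

(** Otherwise the chord lies on the surface and joins the two components. *)
Lemma third_neq0 A B a b : splitting A B -> a != 0 -> b != 0 ->
  A (ppoint a) -> B (ppoint b) -> third a b != 0.
Proof.
move=> sp a0 b0 Aa Bb; have ab := split_indep sp a0 b0 Aa Bb.
have Fa := splitl_cubic sp a0 Aa; have Fb := splitr_cubic sp b0 Bb.
apply/eqP => c0.
have lin := line_in_cubic pT (third_eq0 pT ab Fa Fb c0).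
(* The segment from [a] to [b], which cannot leave [A]. *)
pose g s := (1 - s) *: a + s *: b.
have cg : continuous g by rewrite /g; poly_cont pT.
have g0 s : g s != 0.
  by apply/eqP => /ab[/eqP]; rewrite subr_eq0 => /eqP <- /eqP; rewrite oner_eq0.
have : cone A (g 1).
  apply: (@segment_split R (g @^-1` cone A) (g @^-1` cone B)).
  - exact: closed_preimage cg (closed_cone (split_closedl sp)).
  - exact: closed_preimage cg (closed_cone (split_closedr sp)).
  - by move=> s _; rewrite /= !cone_ppoint//; exact: (split_or sp (g0 s) (lin _ _)).
  - by move=> s _; rewrite /= !cone_ppoint//; apply: split_disjoint.
  - by rewrite /= /g subr0 scale1r scale0r addr0 cone_ppoint.
rewrite /g subrr scale0r add0r scale1r cone_ppoint// => Ab.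
exact: (split_disjoint sp Ab).
Qed.

Lemma thirdZr a b k : third a (k *: b) = k ^+ 2 *: third a b.
Proof.
by rewrite /third_point !(triE pT) scalerBr !scalerA; congr (_ *: _ - _ *: _); ring.
Qed.

Lemma thirdZl a b k : third (k *: a) b = k ^+ 2 *: third a b.
Proof.
by rewrite /third_point !(triE pT) scalerBr !scalerA; congr (_ *: _ - _ *: _); ring.
Qed.

Lemma thirdC a b : third b a = - third a b.
Proof. by rewrite /third_point opprB !(tri_sym pT a b). Qed.

(** This asymmetric condition singles out the component that will be convex. *)
Definition oval A B := forall a b, a != 0 -> b != 0 -> A (ppoint a) -> B (ppoint b) ->
  A (ppoint (third a b)).

Lemma third_cont_r a : continuous (third a).
Proof. by rewrite /third_point; poly_cont pT. Qed.

Lemma third_cont_l b : continuous (third^~ b).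
Proof. by rewrite /third_point; poly_cont pT. Qed.

(** The third point moves continuously when one end moves along its component. *)
Lemma third_constant A B a0 b0 : splitting A B -> a0 != 0 -> b0 != 0 ->
  A (ppoint a0) -> B (ppoint b0) -> A (ppoint (third a0 b0)) -> oval A B.
Proof.
move=> sp a00 b00 Aa0 Bb0 Ac a b an0 bn0 Aa Bb.
have c0 x y := @third_neq0 A B x y sp.
have step x : x != 0 -> A (ppoint x) -> A (ppoint (third x b0)) ->
    A (ppoint (third x b)).
  move=> x0 Ax Axb0; apply/cone_ppoint; first exact: c0.
  apply: (@connected_cone_split R B (third x @^-1` cone A) (third x @^-1` cone B)) => //.
  - exact: split_connr sp.
  - by move=> k y k0 /=; rewrite thirdZr; apply: homogeneous_cone; rewrite expf_neq0.
  - by move=> k y k0 /=; rewrite thirdZr; apply: homogeneous_cone; rewrite expf_neq0.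
  - exact: closed_preimage (@third_cont_r x) (closed_cone (split_closedl sp)).
  - exact: closed_preimage (@third_cont_r x) (closed_cone (split_closedr sp)).
  - move=> y y0 By /=; have n0 := c0 _ _ x0 y0 Ax By.
    rewrite (cone_ppoint A n0) (cone_ppoint B n0); apply: (split_or sp n0).
    exact: (third_cubic pT) (splitl_cubic sp x0 Ax) (splitr_cubic sp y0 By).
  - move=> y y0 By /=; have n0 := c0 _ _ x0 y0 Ax By.
    by rewrite (cone_ppoint A n0) (cone_ppoint B n0); apply: (split_disjoint sp).
  - by exists b0; split=> //=; apply/(cone_ppoint A (c0 _ _ x0 b00 Ax Bb0)).
apply: step => //; apply/cone_ppoint; first exact: c0.
apply: (@connected_cone_split R A (third^~ b0 @^-1` cone A) (third^~ b0 @^-1` cone B)) => //.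
- exact: split_connl sp.
- by move=> k y k0 /=; rewrite thirdZl; apply: homogeneous_cone; rewrite expf_neq0.
- by move=> k y k0 /=; rewrite thirdZl; apply: homogeneous_cone; rewrite expf_neq0.
- exact: closed_preimage (@third_cont_l b0) (closed_cone (split_closedl sp)).
- exact: closed_preimage (@third_cont_l b0) (closed_cone (split_closedr sp)).
- move=> y y0 Ay /=; have n0 := c0 _ _ y0 b00 Ay Bb0.
  rewrite (cone_ppoint A n0) (cone_ppoint B n0); apply: (split_or sp n0).
  exact: (third_cubic pT) (splitl_cubic sp y0 Ay) (splitr_cubic sp b00 Bb0).
- move=> y y0 Ay /=; have n0 := c0 _ _ y0 b00 Ay Bb0.
  by rewrite (cone_ppoint A n0) (cone_ppoint B n0); apply: (split_disjoint sp).
- by exists a0; split=> //=; apply/(cone_ppoint A (c0 _ _ a00 b00 Aa0 Bb0)).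
Qed.

Lemma oval_or A B : splitting A B -> oval A B \/ oval B A.
Proof.
move=> sp; have [a [a0 Aa]] := split_nonzero (split_nel sp).
have [b [b0 Bb]] := split_nonzero (split_ner sp).
have c0 := third_neq0 sp a0 b0 Aa Bb.
have Fc := third_cubic pT (splitl_cubic sp a0 Aa) (splitr_cubic sp b0 Bb).
have [Ac|Bc] := split_or sp c0 Fc; [left|right]; first exact: third_constant Ac.
apply: (third_constant (splittingC sp) b0 a0) => //.
by rewrite thirdC -scaleN1r ppointZ// oppr_eq0 oner_eq0.
Qed.
End TwoComponents.

(** * Lines through a point of the oval *)

Section Oval.
Context (R : realType).
Local Notation V := 'rV[R]_4.
Implicit Types (x y z w q a b u : V) (P Q : P3 R).
Context (F : mpoly 4 R) (T : V -> V -> V -> R) (pT : polarization F T).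
Context (A B : set (P3 R)) (sp : splitting F A B) (ov : oval T A B).
Local Notation cub x := (T x x x).
Local Notation vclass x := (point_class F (ppoint x)).
Local Notation lcl := (line_class F).
Local Notation third := (third_point T).

Let cA a := splitl_cubic pT (x := a) sp.
Let cB b := splitr_cubic pT (x := b) sp.

(** If the chord [ab] were tangent at [b], its third point would be [b], which is
    not in [A]. *)
Lemma oval_tangent_neq0 a b : a != 0 -> b != 0 -> A (ppoint a) -> B (ppoint b) ->
  T a b b != 0.
Proof.
move=> a0 b0 Aa Bb; apply/eqP => t.
have c0 := third_neq0 pT sp a0 b0 Aa Bb.
have := ov a0 b0 Aa Bb; move: c0; rewrite /third_point t scale0r sub0r -scaleNr.
rewrite scaler_eq0 negb_or => /andP[k0 _]; rewrite ppointZ// => Ab.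
exact: (split_disjoint sp Ab).
Qed.

Lemma oval_sign a b b' : a != 0 -> b != 0 -> b' != 0 ->
  A (ppoint a) -> B (ppoint b) -> B (ppoint b') -> 0 < T a b b * T a b' b'.
Proof.
move=> a0 b0 b'0 Aa Bb Bb'.
have tb := oval_tangent_neq0 a0 b0 Aa Bb; have tb' := oval_tangent_neq0 a0 b'0 Aa Bb'.
rewrite lt_neqAle eq_sym mulf_neq0//=.
pose C1 : set V := [set y | 0 <= T a b b * T a y y].
pose C2 : set V := [set y | T a b b * T a y y <= 0].
have scal k y : T a b b * T a (k *: y) (k *: y) = k ^+ 2 * (T a b b * T a y y).
  by rewrite !(triE pT); ring.
suff : C1 b' by [].
apply: (@connected_cone_split R B C1 C2) => //.
- exact: split_connr sp.
- by move=> k y k0; rewrite /C1 /= scal => ty; rewrite mulr_ge0// exprn_even_ge0.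
- by move=> k y k0; rewrite /C2 /= scal => ty; rewrite mulr_ge0_le0// exprn_even_ge0.
- by rewrite /C1; apply: closed_ge0; poly_cont pT.
- by rewrite /C2; apply: closed_le0; poly_cont pT.
- by move=> y y0 By; have [?|?] := leP (T a b b * T a y y) 0; [right|left;
    exact: ltW].
- move=> y y0 By; rewrite /C1 /C2 /= => h1 h2.
  have : T a b b * T a y y == 0 by rewrite eq_le h1 h2.
  by rewrite mulf_eq0 (negPf tb) (negPf (oval_tangent_neq0 a0 y0 Aa By)).
- by exists b; split=> //; rewrite /C1 /= -expr2 exprn_even_ge0.
Qed.

(** A point of [B] on a line through [a] is a simple root of the restriction of the
    form by [oval_tangent_neq0].  The sign change survives on nearby lines, and the
    root found there is close to a point of [B], hence not in [A]. *)
Lemma oval_persist a (g : R -> V) s0 t0 : a != 0 -> A (ppoint a) ->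
  continuous g -> (forall s, indep a (g s)) -> B (ppoint (t0 *: a + g s0)) ->
  \forall s \near s0, exists t, B (ppoint (t *: a + g s)).
Proof.
move=> a0 Aa cg ag Bb.
have Fa := cA a0 Aa.
have n0 t s : t *: a + g s != 0.
  by apply/eqP; rewrite -[g s]scale1r => /(ag s)[_ /eqP]; rewrite oner_eq0.
set b := t0 *: a + g s0 in Bb.
have b0 : b != 0 by exact: n0.
have Fb : cub b = 0 by exact: cB.
have D0 : T a b b != 0 by apply: oval_tangent_neq0.
set D := T a b b in D0.
pose f t s := cub (t *: a + g s).
have fE h : f (t0 + h) s0 = 3 * h * D + 3 * h ^+ 2 * T a a b.
  have E : (t0 + h) *: a + g s0 = h *: a + 1 *: b.
    by rewrite scale1r /b scalerDl (addrC (t0 *: a)) addrA.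
  by rewrite /f E (cubic_comb pT) Fa Fb /D; ring.
have nA : nbhs (t0, s0) [set p : R * R | ~ cone A (p.1 *: a + g p.2)].
  apply: open_nbhs_nbhs; split; last first.
    by rewrite /= cone_ppoint//; move=> /(split_disjoint sp).
  rewrite openC; apply: closed_preimage (closed_cone (split_closedl sp)) => p.
  apply: continuous_at_add; last first.
    by apply: (@continuous_comp _ _ _ snd g); [exact: cvg_snd|exact: cg].
  by apply: continuous_at_scale; [exact: cvg_fst|exact: cst_continuous].
have [e /= e0 He] : exists2 e : R, 0 < e &
    (forall t s, `|t - t0| < e -> `|s - s0| < e -> ~ cone A (t *: a + g s)).
  have /nbhs_ballP[e /= e0 He] := nA; exists e => // t s te se.
  by apply: (He (t, s)); split; rewrite /= /ball /= distrC.
set p := T a a b in fE.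
(* Small enough for the linear term of [f (t0 + h) s0] to dominate. *)
pose h := Num.min (e / 2) (`|D| / (2 * (`|p| + 1))).
have p1 : 0 < 2 * (`|p| + 1) by rewrite mulr_gt0// ltr_wpDl.
have h0 : 0 < h by rewrite lt_min !divr_gt0// normr_gt0.
have hp : `|h * p * D| < D ^+ 2.
  rewrite -(real_normK (num_real D)) expr2 normrM ltr_pM2r ?normr_gt0// normrM gtr0_norm//.
  have : h <= `|D| / (2 * (`|p| + 1)) by rewrite ge_min lexx orbT.
  rewrite ler_pdivlMr// => hD; apply: lt_le_trans hD.
  by rewrite ltr_pM2l// mulrDr mulr1; have := normr_ge0 p; lra.
have signs : 0 < D * f (t0 + h) s0 /\ D * f (t0 + - h) s0 < 0.
  move: hp; rewrite ltr_norml => /andP[h1 h2]; rewrite !fE; split.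
    rewrite (_ : D * _ = (3 * h) * (D ^+ 2 + h * p * D)); last by ring.
    by rewrite mulr_gt0// ?mulr_gt0//; lra.
  rewrite (_ : D * _ = (3 * h) * (h * p * D - D ^+ 2)); last by ring.
  by rewrite nmulr_llt0 ?mulr_gt0//; lra.
have cf t : continuous (fun s => D * f t s).
  move=> s; apply: continuous_at_mul; first exact: cst_continuous.
  have c1 : continuous_at s (fun s => t *: a + g s).
    by apply: continuous_at_add; [exact: cst_continuous|exact: cg].
  exact: (continuous_at_tri pT).
have near1 : \forall s \near s0, 0 < D * f (t0 + h) s.
  by apply: open_nbhs_nbhs; split; [exact: open_gt0|exact: signs.1].
have near2 : \forall s \near s0, D * f (t0 + - h) s < 0.
  by apply: open_nbhs_nbhs; split; [exact: open_lt0|exact: signs.2].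
have near3 : \forall s \near s0, `|s - s0| < e.
  by apply/nbhs_ballP; exists e => // s; rewrite /ball /= distrC.
near=> s.
have [t [th ft]] : exists t, `|t - t0| < e /\ f t s = 0.
  have [|||t tin Dft] := @IVT R (fun t => D * f t s) (t0 + - h) (t0 + h) 0.
  - by lra.
  - apply: continuous_subspaceT; rewrite /f; poly_cont pT.
  - by rewrite ge_min le_max; apply/andP; split; apply/orP; [left|right];
      apply: ltW; near: s.
  exists t; split.
    move: tin; rewrite in_itv /= => /andP[t1 t2].
    apply: (@le_lt_trans _ _ h); first by rewrite ler_norml; lra.
    apply: (@le_lt_trans _ _ (e / 2)); first by rewrite ge_min lexx.
    by lra.
  by apply/eqP; move/eqP: Dft; rewrite mulf_eq0 (negPf D0).
exists t; have [At|//] := split_or pT sp (n0 t s) ft.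
exfalso; apply: (He t s th); first by near: s.
exact/cone_ppoint.
Unshelve. all: by end_near.
Qed.

(** The lines are parametrized by a compact circle of directions, none of which is
    lost to [a] since [a] is not in [B]. *)
Lemma oval_hit_closed a (g : R -> V) : a != 0 -> A (ppoint a) ->
  continuous g -> (forall s, indep a (g s)) ->
  closed [set s | exists t, B (ppoint (t *: a + g s))].
Proof.
move=> a0 Aa cg ag; rewrite -openC openE => s0 /= nB.
(* The points of the line are taken on a circle, not on an affine line, to have
   compactness. *)
pose G (q : 'rV[R]_2 * R) := q.1 ord0 ord0 *: a + q.1 ord0 ord_max *: g q.2.
have cG : continuous G.
  move=> q; apply: continuous_at_add; apply: continuous_at_scale.
  - apply: (@continuous_comp _ _ _ fst (fun v : 'rV[R]_2 => v ord0 ord0));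
      first exact: cvg_fst.
    exact: coord_continuous.
  - exact: cst_continuous.
  - apply: (@continuous_comp _ _ _ fst (fun v : 'rV[R]_2 => v ord0 ord_max));
      first exact: cvg_fst.
    exact: coord_continuous.
  - by apply: (@continuous_comp _ _ _ snd g); [exact: cvg_snd|exact: cg].
have cC := closed_preimage cG (closed_cone (split_closedr sp)).
have /= := compact_tube (y0 := s0) (@sphere_compact R 2) cC.
case=> [v /= v1|e /= e0 He].
  rewrite /G /=; set c := v ord0 ord0; set d := v ord0 ord_max.
  have cd : (c != 0) || (d != 0).
    apply: contra_eqT v1; rewrite negb_or !negbK => /andP[/eqP c0 /eqP d0].
    rewrite (_ : v = 0) ?normr0 1?eq_sym ?oner_eq0//; apply/rowP => i; rewrite mxE.
    by case: i => [[|[|//]] hi]; [rewrite -c0|rewrite -d0]; congr (v _ _);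
      apply: val_inj.
  have n0 : c *: a + d *: g s0 != 0.
    by apply/eqP => /(ag s0)[c0 d0]; move: cd; rewrite c0 d0 eqxx.
  rewrite cone_ppoint//; have [d0|d0] := eqVneq d 0.
    move: n0; rewrite d0 scale0r addr0 scaler_eq0 negb_or => /andP[c0 _].
    by rewrite ppointZ//; exact: (split_disjoint sp Aa).
  move=> Bv; apply: nB; exists (c / d).
  rewrite -(ppointZ d0); first by rewrite scalerDr scalerA mulrCA divff// mulr1.
  apply: contra_neq n0 => e;
    rewrite -(scaler0 _ d) -e scalerDr scalerA mulrCA divff//.
  by rewrite mulr1.
exists e => // s /He Hs /= [t Bt].
pose v : 'rV[R]_2 := \row_i (if i == ord0 then t else 1).
have v0 : v != 0.
  by apply/eqP => /rowP/(_ ord_max)/eqP; rewrite !mxE /= oner_eq0.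
have nv : `|v| != 0 by rewrite normr_eq0.
have n0 : t *: a + g s != 0.
  by apply/eqP; rewrite -[g s]scale1r => /(ag s)[_ /eqP]; rewrite oner_eq0.
apply: (Hs (`|v|^-1 *: v)); first by rewrite /= normrZ normfV normr_id mulVf.
rewrite /G /= [in X in X *: a]mxE [in X in X *: g s]mxE -!scalerA -scalerDr.
apply: homogeneous_cone; first by rewrite invr_eq0.
by rewrite !mxE /= scale1r cone_ppoint.
Qed.

(** Turn a line joining [a] to a point of [B] until it becomes the given line: the
    condition of meeting [B] is both open and closed. *)
Lemma oval_line_meets a u : A (ppoint a) -> indep a u ->
  exists s t, s *: a + t *: u != 0 /\ B (ppoint (s *: a + t *: u)).
Proof.
move=> Aa au; have a0 := indep_neq0l au.
have [b0 [b0n Bb0]] := split_nonzero (split_ner sp).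
have [[k1 [k2 bE]]|nspan] := pselect (exists k1 k2, b0 = k1 *: a + k2 *: u).
  by exists k1, k2; rewrite -bE.
pose g s := (1 - s) *: b0 + s *: u.
have cg : continuous g by rewrite /g; poly_cont pT.
have ag s : indep a (g s).
  move=> x y; rewrite /g scalerDr !scalerA => e.
  have y0 : y = 0.
    have [//|yn0] := eqVneq y 0; exfalso.
    have [s1|s1] := eqVneq (1 - s) 0.
      have [|_ /eqP] := au x (y * s); first by rewrite -e s1 mulr0 scale0r add0r.
      by rewrite mulf_eq0 (negPf yn0) /=; move/eqP: s1; rewrite subr_eq0 => /eqP <-;
        rewrite oner_eq0.
    apply: nspan; exists (- x / (y * (1 - s))), (- (y * s) / (y * (1 - s))).
    have k0 : y * (1 - s) != 0 by rewrite mulf_neq0.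
    apply: (scalerI k0);
      rewrite scalerDr !scalerA !(mulrCA (y * (1 - s))) divff// !mulr1.
    by apply/eqP; rewrite !scaleNr -opprD -addr_eq0 addrCA e.
  split=> //; apply/eqP; move/eqP: e; rewrite y0 !mul0r !scale0r !addr0.
  by rewrite scaler_eq0 (negPf a0) orbF.
pose C1 : set R := [set s | exists t, B (ppoint (t *: a + g s))].
have [t Bt] : C1 1; last first.
  exists t, 1; rewrite scale1r; split.
    by apply/eqP; rewrite -[u]scale1r => /au[_ /eqP]; rewrite oner_eq0.
  by move: Bt; rewrite /g subrr scale0r add0r scale1r.
apply: (@segment_split R C1 (~` C1)).
- exact: oval_hit_closed.
- rewrite closedC openE => s [t Bt]; exact: oval_persist Bt.
- by move=> s _; have [?|?] := pselect (C1 s); [left|right].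
- by move=> s _ h /(_ h).
- by exists 0; rewrite /g scale0r add0r subr0 scale1r scale0r addr0.
Qed.

(** There is a tangent from [b] to [A]: for a chord of [A] through [b], the values
    of [T y y b] at its two ends [y] have opposite signs, and [A] is connected. *)
Lemma oval_base_class b : b != 0 -> B (ppoint b) -> base_class F T b.
Proof.
move=> b0 Bb; have Fb := cB b0 Bb.
have [[a [an0 Aa t]]|nt] := pselect (exists a, [/\ a != 0, A (ppoint a) & T a a b = 0]).
  apply: (base_class_tangent pT (split_indep sp an0 b0 Aa Bb)) => //; exact: cA.
exfalso.
have [a [a0 Aa]] := split_nonzero (split_nel sp).
pose p0 := T a a b.
have nz y : y != 0 -> A (ppoint y) -> T y y b != 0.
  by move=> y0 Ay; apply/eqP => t; apply: nt; exists y.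
pose C1 : set V := [set y | 0 <= p0 * T y y b].
pose C2 : set V := [set y | p0 * T y y b <= 0].
have scal k y : p0 * T (k *: y) (k *: y) b = k ^+ 2 * (p0 * T y y b).
  by rewrite !(triE pT); ring.
have c0 := third_neq0 pT sp a0 b0 Aa Bb.
have : C1 (third a b).
  apply: (@connected_cone_split R A C1 C2) => //.
  - exact: split_connl sp.
  - by move=> k y k0; rewrite /C1 /= scal => ty; rewrite mulr_ge0// exprn_even_ge0.
  - by move=> k y k0; rewrite /C2 /= scal => ty;
      rewrite mulr_ge0_le0// exprn_even_ge0.
  - by rewrite /C1; apply: closed_ge0; poly_cont pT.
  - by rewrite /C2; apply: closed_le0; poly_cont pT.
  - by move=> y y0 By; have [?|?] := leP (p0 * T y y b) 0; [right|left; exact: ltW].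
  - move=> y y0 Ay; rewrite /C1 /C2 /= => h1 h2.
    have : p0 * T y y b == 0 by rewrite eq_le h1 h2.
    by rewrite mulf_eq0 (negPf (nz _ a0 Aa)) (negPf (nz _ y0 Ay)).
  - by exists a; split=> //; rewrite /C1 /= -expr2 exprn_even_ge0.
  - exact: ov.
rewrite /C1 /= leNgt => /negP; apply.
have -> : p0 * T (third a b) (third a b) b = - (p0 * T a b b) ^+ 2.
  rewrite /third_point -scaleNr !(triE pT) !(tri_sym pT a b) Fb -/p0; ring.
rewrite oppr_lt0 exprn_even_gt0//= mulf_neq0 ?nz//.
exact: oval_tangent_neq0.
Qed.

Lemma oval_chord_points a b s t : a != 0 -> b != 0 -> A (ppoint a) -> B (ppoint b) ->
  s != 0 -> t != 0 -> cub (s *: a + t *: b) = 0 ->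
  ppoint (s *: a + t *: b) = ppoint (third a b).
Proof.
move=> a0 b0 Aa Bb s0 t0; rewrite (cubic_comb pT) (cA a0 Aa) (cB b0 Bb).
have tb := oval_tangent_neq0 a0 b0 Aa Bb.
have c0 := third_neq0 pT sp a0 b0 Aa Bb.
set p := T a a b; set q := T a b b in tb *.
move=> e; have {}e : s * p + t * q = 0.
  apply: (@mulfI _ (3 * s * t)); first by rewrite !mulf_neq0// pnatr_eq0.
  by rewrite mulr0 -e; ring.
have te : t = s / q * - p by apply: (mulfI tb); move: e; rewrite (mulrC t) => /eqP;
  rewrite addrC addr_eq0 => /eqP->; field.
have se : s = s / q * q by rewrite divfK.
rewrite -(@ppointZ R (s / q) (third a b))//; last by rewrite mulf_neq0// invr_eq0.
by rewrite /third_point scalerBr !scalerA -/p -/q -se -scaleNr -mulrN -te.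
Qed.

(** The chord through two points of [A] meets [B], at a point of the base class. *)
Lemma oval_same_class a a' : a != 0 -> a' != 0 -> A (ppoint a) -> A (ppoint a') ->
  vclass a = vclass a'.
Proof.
move=> a0 a'0 Aa Aa'; have [->//|/eqP aa'] := eqVneq (ppoint a) (ppoint a').
have {}aa' := indep_ppoint a0 a'0 aa'.
have [s [t [b0 Bb]]] := oval_line_meets Aa aa'.
set b := s *: a + t *: a' in b0 Bb.
have c0 := third_neq0 pT sp a0 b0 Aa Bb.
have Fa := cA a0 Aa; have Fb := cB b0 Bb; have Fa' := cA a'0 Aa'.
have t0 : t != 0.
  apply/eqP => t0; move: b0 Bb; rewrite /b t0 scale0r addr0 scaler_eq0 negb_or.
  by move=> /andP[s0 _]; rewrite ppointZ//; exact: (split_disjoint sp Aa).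
have s0 : s != 0.
  apply/eqP => s0; move: b0 Bb; rewrite /b s0 scale0r add0r scaler_eq0 negb_or.
  by move=> /andP[_ _]; rewrite ppointZ//; exact: (split_disjoint sp Aa').
have a'E : a' = (- s / t) *: a + t^-1 *: b.
  by rewrite /b scalerDr !scalerA mulVf// scale1r addrA -scalerDl mulNr (mulrC s) addNr scale0r add0r.
have e : ppoint a' = ppoint (third a b).
  rewrite a'E; apply: oval_chord_points => //.
  - by rewrite mulf_neq0 ?oppr_eq0// invr_eq0.
  - by rewrite invr_eq0.
  - by rewrite -a'E.
have := line_triple_chord pT (split_indep sp a0 b0 Aa Bb) Fa Fb c0.
move=> /(class_triple pT a0 b0 c0 Fa Fb (third_cubic pT Fa Fb)).
rewrite -e -(oval_base_class b0 Bb a0 Fa) mulr2n -!addrA => /addrI.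
by rewrite addrC => /addIr.
Qed.
End Oval.

Section Parity.
Context (R : realType).
Local Notation V := 'rV[R]_4.
Implicit Types (x y z w q a b u : V) (P Q : P3 R).
Context (F : mpoly 4 R) (T : V -> V -> V -> R) (pT : polarization F T).
Context (A B : set (P3 R)) (sp : splitting F A B) (ov : oval T A B).
Local Notation cub x := (T x x x).
Local Notation third := (third_point T).

Lemma line_span_change a w s t : t != 0 ->
  (line_span a w == line_span a (s *: a + t *: w))%MS.
Proof.
move=> t0; have sa u : (a <= line_span a u)%MS.
  by apply/sub_line_span; exists 1, 0; rewrite scale1r scale0r addr0.
rewrite !line_span_sub !sa /=; apply/andP; split; apply/sub_line_span.
  exists (- s / t), t^-1.
  by rewrite scalerDr !scalerA mulVf// scale1r addrA -scalerDl mulNr (mulrC s) addNr scale0r add0r.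
by exists s, t.
Qed.

(** Brings a line meeting [A] to the form required by [line_cut_chord]. *)
Lemma oval_line (L : 'M[R]_(2, 4)) X : row_free L -> on_line L X -> A X ->
  exists a b, [/\ a != 0, b != 0, A (ppoint a), B (ppoint b) & (L == line_span a b)%MS].
Proof.
have [x [y ->]] := line_span_of L => /row_free_line_span xy lX AX.
have [w aw Lw] := line_span_complete xy (hcoord_neq0 X) lX.
have Aa : A (ppoint (hcoord X)) by rewrite hcoordK.
have [s [t [b0 Bb]]] := oval_line_meets pT sp ov Aa aw.
exists (hcoord X), (s *: hcoord X + t *: w); split=> //; first exact: hcoord_neq0.
have t0 : t != 0.
  apply/eqP => t0; move: b0 Bb; rewrite t0 scale0r addr0 scaler_eq0 negb_or.
  by move=> /andP[s0 x0]; rewrite ppointZ//; exact: (split_disjoint sp Aa).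
apply/eqmxP; apply: eqmx_trans (eqmx_sym (eqmxP Lw)) _.
exact/eqmxP/line_span_change.
Qed.

(** A line that meets [A] is a chord from [a] to [b], and its third point is in [A]. *)
Lemma oval_parity P Q Q' : line_triple F P Q Q' ->
  ~~ odd (`[< A P >] + `[< A Q >] + `[< A Q' >]).
Proof.
move=> [L Lf H].
have [[X [lX AX]]|nX] := pselect (exists X, on_line L X /\ A X); last first.
  have [lP lQ lQ'] : [/\ on_line L P, on_line L Q & on_line L Q'].
    by case: H => [[_ []]|[]].
  have nA X : on_line L X -> `[< A X >] = false.
    by move=> lX; apply/asboolPn => AX; apply: nX; exists X.
  by rewrite !nA.
have [a [b [a0 b0 Aa Bb Lab]]] := oval_line Lf lX AX.
have ab := split_indep sp a0 b0 Aa Bb.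
have Fa := splitl_cubic pT sp a0 Aa; have Fb := splitr_cubic pT sp b0 Bb.
have c0 := third_neq0 pT sp a0 b0 Aa Bb.
have Ac := ov a0 b0 Aa Bb.
case: H => [[_ cut]|[lin _ _ _]]; last first.
  have lab := line_in_cubic pT (line_in_eqmx Lab lin).
  have := lab 1 1; have := lab 1 (-1); rewrite !(cubic_comb pT) Fa Fb => e1 e2.
  have p0 : T a a b = 0 by lra.
  have q0 : T a b b = 0 by lra.
  by move: c0; rewrite /third_point p0 q0 !scale0r subrr eqxx.
have cut' := line_cut_chord pT ab Fa Fb c0.
have /permP/(_ (fun X => `[< A X >])) := line_cut_unique (proj2 (row_free_line_span a b) ab)
  (line_cut_eqmx Lab cut) cut'.
rewrite /= !addn0 -!addnA => ->.
have -> : `[< A (ppoint a) >] by exact/asboolP.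
have -> : `[< A (ppoint (third a b)) >] by exact/asboolP.
by have /asboolPn/negbTE -> : ~ A (ppoint b) by move=> /(split_disjoint sp).
Qed.
End Parity.

(** * Convexity of the components *)

Section NotConvex.
Context (R : realType).
Local Notation V := 'rV[R]_4.
Implicit Types (x y z w q a b u : V) (P Q : P3 R).
Context (F : mpoly 4 R) (T : V -> V -> V -> R) (pT : polarization F T).
Context (A B : set (P3 R)) (sp : splitting F A B) (ov : oval T A B).
Local Notation cub x := (T x x x).

(** Otherwise the ray would stay in [K], which is bounded. *)
Lemma ray_boundary n (K : set 'rV[R]_n) (y d : 'rV[R]_n) : compact K -> K° y ->
  d != 0 ->
  exists2 t, 0 < t & K (y + t *: d) /\ ~ K° (y + t *: d).
Proof.
move=> cK Ky d0; apply: contrapT => nt.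
have step t : 0 < t -> K (y + t *: d) -> K° (y + t *: d).
  by move=> t0 Kt; apply: contrapT => h; apply: nt; exists t.
have clK : closed K := compact_closed (@norm_hausdorff _ _) cK.
have ray N : 0 < N -> K (y + N *: d).
  move=> N0; pose g s := y + (s * N) *: d.
  have cg : continuous g.
    move=> s; apply: continuous_at_add; first exact: cst_continuous.
    apply: continuous_at_scale; last exact: cst_continuous.
    by apply: continuous_at_mul; [exact: cvg_id|exact: cst_continuous].
  have : K (g 1); last by rewrite /g mul1r.
  apply: (@segment_split R (g @^-1` K) (g @^-1` (~` K°))).
  - exact: closed_preimage cg clK.
  - apply: closed_preimage cg _; rewrite closedC; exact: open_interior.
  - by move=> s _ /=; have [?|h] := pselect (K (g s));
      [left|right=> /interior_subset].
  - move=> s /andP[s0 _] /= Ks; apply; rewrite /g.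
    have [e|sn] := eqVneq s 0; first by rewrite e mul0r scale0r addr0.
    by apply: step; rewrite // mulr_gt0// lt_neqAle eq_sym sn.
  - by rewrite /= /g mul0r scale0r addr0; exact: interior_subset.
(* A point of the ray out of the bounded set [K]. *)
have [M [_ HM]] := compact_bounded cK.
have nd : 0 < `|d| by rewrite normr_gt0.
pose M1 := `|M| + 1.
have M1M : M < M1 by rewrite /M1 (le_lt_trans (ler_norm M))// ltrDl.
have M10 : 0 < M1 by rewrite /M1 ltr_wpDl.
pose N := (M1 + `|y| + 1) / `|d|.
have y0 := normr_ge0 y.
have N0 : 0 < N by rewrite divr_gt0//; lra.
have Nd : `|N *: d| = M1 + `|y| + 1.
  by rewrite normrZ gtr0_norm// /N divfK ?gt_eqF.
have h1 : `|y + N *: d| <= M1 := HM M1 M1M _ (ray N N0).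
have h2 : M1 + `|y| + 1 <= `|y + N *: d| + `|y|.
  by rewrite -Nd -{1}(addKr y (N *: d)) addrC; exact: ler_normB.
by move: h1 h2; generalize `|y + N *: d| => r; lra.
Qed.

(** The line joining a point of [A] to an interior point of the body crosses the
    boundary on both sides of this interior point, but it is a chord from [A] to
    [B], and these meet [B] once. *)
Lemma is_convex_not_right : ~ is_convex B.
Proof.
move=> [M [K [Mu cK _ [y Ky] BE]]].
pose g (r : R) (x : 'rV[R]_3) : V := row_mx (r%:M : 'M[R]_1) x *m M.
have gD r r' (x x' : 'rV[R]_3) t t' : g (t * r + t' * r') (t *: x + t' *: x') = t *: g r x + t' *: g r' x'.
  by rewrite /g !scalemxAl -mulmxDl !scale_row_mx add_row_mx !scale_scalar_mx -raddfD.
have g_inj r (x : 'rV[R]_3) : g r x = 0 -> r = 0 /\ x = 0.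
  move=> /(congr1 (mulmx^~ (invmx M))); rewrite mulmxK// mul0mx => e.
  have : row_mx (r%:M : 'M[R]_1) x = row_mx 0 0 by rewrite row_mx0.
  by move=> /eq_row_mx[/matrixP/(_ ord0 ord0) + ->]; rewrite !mxE /= mulr1n.
have [a [a0 Aa]] := split_nonzero (split_nel sp).
have [al [v aE]] : exists al v, a = g al v.
  exists ((lsubmx (a *m invmx M : 'M[R]_(1, 1 + 3))) ord0 ord0), (rsubmx (a *m invmx M : 'M[R]_(1, 1 + 3))).
  by rewrite /g -mx11_scalar hsubmxK mulmxKV.
(* A direction [d] such that the line through [y] along [d] contains [a]; any
   direction will do if [a] is the point [y]. *)
have [d [d0 [s [t aE2]]]] : exists d, d != 0 /\ exists s t, a = s *: g 1 y + t *: g 0 d.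
  have [dz|dn] := eqVneq (v - al *: y) 0.
    exists (const_mx 1); split.
      by apply/eqP => /rowP/(_ ord0)/eqP; rewrite !mxE oner_eq0.
    exists al, 0; rewrite scale0r addr0 aE -[al *: g 1 y]addr0 -(scale0r (g 0 0)) -gD.
    by rewrite mulr1 mulr0 addr0 scaler0 addr0; congr g; apply/eqP;
      rewrite -subr_eq0 dz.
  exists (v - al *: y); split=> //; exists al, 1;
    rewrite -gD mulr1 mulr0 addr0 scale1r.
  by rewrite addrC subrK.
have g1 (x : 'rV[R]_3) : g 1 x != 0 by apply/eqP => /g_inj[/eqP]; rewrite oner_eq0.
have bd r (x : 'rV[R]_3) : K x -> ~ K° x -> x = y + r *: d -> B (ppoint (g 1 x)).
  move=> Kx nKx xE; rewrite BE /=; exists x.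
    by split=> //; exact: subset_closure.
  by have [k k0 ->] := hcoord_ppoint (g1 x); apply: (colinear_eqmx k0).
have [t1 t10 [K1 nK1]] := ray_boundary cK Ky d0.
have [|t2 t20 [K2 nK2]] := @ray_boundary _ K y (- d) cK Ky; first by rewrite oppr_eq0.
set b1 := g 1 (y + t1 *: d); set b2 := g 1 (y + t2 *: - d).
have B1 : B (ppoint b1) by exact: (bd t1).
have B2 : B (ppoint b2) by apply: (bd (- t2)) => //; rewrite scalerN scaleNr.
have b10 : b1 != 0 by exact: g1.
have b20 : b2 != 0 by exact: g1.
have b1E : b1 = 1 *: g 1 y + t1 *: g 0 d by rewrite -gD mulr1 mulr0 addr0 scale1r.
have b2E : b2 = 1 *: g 1 y + (- t2) *: g 0 d.
  by rewrite -gD mulr1 mulr0 addr0 scale1r scaleNr -scalerN.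
have I : indep (g 1 y) (g 0 d).
  move=> c c'; rewrite -gD mulr1 mulr0 addr0 => /g_inj[-> /eqP].
  by rewrite scale0r add0r scaler_eq0 (negPf d0) orbF => /eqP->.
have b12 : indep b1 b2.
  rewrite b1E b2E; apply: indep_comb => //; rewrite !mul1r !mulr1.
  by rewrite lt_eqF//; lra.
have ab1 := split_indep sp a0 b10 Aa B1.
have [x [z b2ab1]] : exists x z : R, b2 = x *: a + z *: b1.
  have D0 : s * t1 - t * 1 != 0.
    apply/eqP => D0; have [] := ab1 1 (- s).
      rewrite aE2 b1E scale1r scalerDr !scalerA mulr1 mulNr addrACA -scalerDl subrr scale0r add0r.
      by rewrite -scalerDl -(opprB _ t) -{1}(mulr1 t) D0 oppr0 scale0r.
    by move=> /eqP; rewrite oner_eq0.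
  pose D := s * t1 - t * 1.
  exists ((t1 + t2) / D), ((- t - t2 * s) / D).
  rewrite aE2 b1E b2E !scalerDr !scalerA addrACA -!scalerDl.
  by congr (_ *: _ + _ *: _); rewrite /D; field; move: D0; rewrite mulr1.
have [x0|x0] := eqVneq x 0.
  have [] := b12 (- z) 1; last by move=> _ /eqP; rewrite oner_eq0.
  by rewrite b2ab1 x0 scale0r add0r scale1r scaleNr addNr.
have [z0|z0] := eqVneq z 0.
  have : A (ppoint b2) by rewrite b2ab1 z0 scale0r addr0 ppointZ.
  by move=> /(split_disjoint sp).
have := oval_chord_points pT sp ov a0 b10 Aa B1 x0 z0.
rewrite -b2ab1 => /(_ (splitr_cubic pT sp b20 B2)) e.
by have := ov a0 b10 Aa B1; rewrite -e => /(split_disjoint sp).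
Qed.
End NotConvex.

Lemma mulmx_row_continuous (R : realType) n m (D : 'M[R]_(n, m)) :
  continuous (fun x : 'rV[R]_n => x *m D).
Proof.
move=> x.
rewrite (_ : (fun _ => _) = (fun x : 'rV[R]_n => \sum_i x ord0 i *: row i D));
  last first.
  by apply/funext => y; rewrite mulmx_sum_row.
elim: (index_enum _) => [|i r IH].
  rewrite (_ : (fun _ => _) = cst 0); first exact: cst_continuous.
  by apply/funext => y; rewrite big_nil.
rewrite (_ : (fun _ => _) = (fun x : 'rV[R]_n => x ord0 i *: row i D +
    \sum_(j <- r) x ord0 j *: row j D)).
  apply: continuous_at_add => //; apply: continuous_at_scale;
    last exact: cst_continuous.
  exact: coord_continuous.
by apply/funext => y; rewrite big_cons.
Qed.

Section Convex.
Context (R : realType).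
Local Notation V := 'rV[R]_4.
Local Notation W := 'rV[R]_3.
Implicit Types (y z w q a b u : V) (P Q : P3 R).
Context (F : mpoly 4 R) (T : V -> V -> V -> R) (pT : polarization F T).
Context (sF : real_smooth F).
Context (A B : set (P3 R)) (sp : splitting F A B) (ov : oval T A B).
Local Notation cub x := (T x x x).
Context (b0 : V) (b0n : b0 != 0) (Bb0 : B (ppoint b0)).

(** Its zero set is the tangent plane at [b0], which does not meet [A]; it will be
    the plane at infinity. *)
Let lam y := T b0 b0 y.

Definition chart_point a := lam a = 1 /\ A (ppoint a).

Lemma lamE a : lam a = T a b0 b0.
Proof. by rewrite /lam (tri_sym pT a b0). Qed.

Lemma lam_neq0 a : a != 0 -> A (ppoint a) -> lam a != 0.
Proof. by move=> a0 Aa; rewrite lamE; exact: (oval_tangent_neq0 pT sp ov). Qed.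

Lemma lam_lin s t y z : lam (s *: y + t *: z) = s * lam y + t * lam z.
Proof. by rewrite /lam !(triE pT). Qed.

Lemma lamZ s y : lam (s *: y) = s * lam y.
Proof. by rewrite /lam !(triE pT). Qed.

Lemma lam1_neq0 a : lam a = 1 -> a != 0.
Proof. by apply: contra_eq_neq => ->;
  rewrite -(scale0r 0) lamZ mul0r eq_sym oner_eq0. Qed.

Lemma lam1_indep a a' : lam a = 1 -> lam a' = 1 -> a != a' -> indep a a'.
Proof.
move=> la la' aa'; apply: contrapT => /(not_indep (lam1_neq0 la))[k E].
by move: la' aa'; rewrite E lamZ la mulr1 => ->; rewrite scale1r eqxx.
Qed.

Lemma chart_point_normalize a : a != 0 -> A (ppoint a) ->
  chart_point ((lam a)^-1 *: a).
Proof.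
move=> a0 Aa; have l0 := lam_neq0 a0 Aa; split; first by rewrite lamZ mulVf.
by rewrite ppointZ// invr_eq0.
Qed.

Lemma chart_point_cubic a : chart_point a -> cub a = 0.
Proof. by case=> la Aa; apply: (splitl_cubic pT sp) => //; exact: lam1_neq0. Qed.

(** The chord [a a'] meets [B] at a point [b = s a + t a'], and the restriction of
    the form is proportional to [s p + t q] where [p = T a a a'] and
    [q = T a a' a'].  The numbers [T a b b = s t p] and [T a' b b = s t q] are
    positive by [oval_sign], as [T a b0 b0 = lam a = 1].  So [p] and [q] have the
    same sign, and [s p + t q = 0] forces [s t < 0]. *)
Lemma oval_support a a' : chart_point a -> chart_point a' -> a != a' -> T a a a' < 0.
Proof.
move=> [la Aa] [la' Aa'] ne; have aa' := lam1_indep la la' ne.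
have a0 := lam1_neq0 la; have a'0 := lam1_neq0 la'.
have [s [t [bn Bb]]] := oval_line_meets pT sp ov Aa aa'.
set b := s *: a + t *: a' in bn Bb.
have Fa := chart_point_cubic (conj la Aa);
  have Fa' := chart_point_cubic (conj la' Aa').
have Fb := splitr_cubic pT sp bn Bb.
have tab := oval_sign pT sp ov a0 bn b0n Aa Bb Bb0.
have ta'b := oval_sign pT sp ov a'0 bn b0n Aa' Bb Bb0.
move: tab ta'b; rewrite -!lamE la la' !mulr1.
set p := T a a a'; set q := T a a' a'.
have -> : T a b b = t * (2 * (s * p) + t * q).
  by rewrite /b !(triE pT) !(tri_sym pT a a') Fa /p /q; ring.
have -> : T a' b b = s * (s * p + 2 * (t * q)).
  by rewrite /b !(triE pT) !(tri_sym pT a a') Fa' /p /q; ring.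
move=> h1 h2.
have st0 : s * t != 0.
  apply/eqP => st0.
  have [s0|s0] := eqVneq s 0; first by move: h2; rewrite s0 mul0r ltxx.
  by move/eqP: st0; rewrite mulf_eq0 (negPf s0) => /eqP t0; move: h1;
    rewrite t0 mul0r ltxx.
have e : s * p + t * q = 0.
  apply: (@mulfI _ (3 * (s * t))); first by rewrite mulf_neq0// pnatr_eq0.
  by move: Fb; rewrite /b (cubic_comb pT) Fa Fa' -/p -/q => Fb';
    rewrite mulr0 -[RHS]Fb'; ring.
have h1' : 0 < s * t * p.
  rewrite (_ : s * t * p = t * (2 * (s * p) + t * q) - t * (s * p + t * q));
    last by ring.
  by rewrite e mulr0 subr0.
have h2' : 0 < s * t * q.
  rewrite (_ : s * t * q = s * (s * p + 2 * (t * q)) - s * (s * p + t * q));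
    last by ring.
  by rewrite e mulr0 subr0.
rewrite ltNge; apply/negP => p0.
have st : 0 < s * t.
  by rewrite ltNge; apply/negP => st; move: h1'; rewrite ltNge mulr_le0_ge0.
have q0 : 0 < q by rewrite -(pmulr_rgt0 _ st).
have : s * (s * p + t * q) = 0 by rewrite e mulr0.
rewrite mulrDr !mulrA => /eqP; rewrite gt_eqF// ltr_wpDl//.
by rewrite -expr2 mulr_ge0// sqr_ge0.
Qed.

Lemma oval_support_le a a' : chart_point a -> chart_point a' -> T a a a' <= 0.
Proof.
move=> Aa Aa'; have [<-|ne] := eqVneq a a'; first by rewrite (chart_point_cubic Aa).
exact/ltW/oval_support.
Qed.

(** A line through [a] that is not tangent there meets [A] again. *)
Lemma second_point a y : chart_point a -> T a a y != 0 ->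
  exists a' s t, [/\ chart_point a', a != a' & y = s *: a + t *: a'].
Proof.
move=> [la Aa] tay; have a0 := lam1_neq0 la;
  have Fa := chart_point_cubic (conj la Aa).
have ay : indep a y.
  apply: contrapT => /(not_indep a0)[k yE].
  by move: tay; rewrite yE (triZ3 pT) Fa mulr0 eqxx.
have [s [t [bn Bb]]] := oval_line_meets pT sp ov Aa ay.
set b := s *: a + t *: y in bn Bb.
have t0 : t != 0.
  apply/eqP => t0; move: bn Bb; rewrite /b t0 scale0r addr0 scaler_eq0 negb_or.
  by move=> /andP[s0 _]; rewrite ppointZ//; exact: (split_disjoint sp Aa).
have ab := split_indep sp a0 bn Aa Bb.
have cn := third_neq0 pT sp a0 bn Aa Bb.
have Ac := ov a0 bn Aa Bb.
have p0 : T a a b != 0 by rewrite /b !(triE pT) Fa mulr0 add0r mulf_neq0.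
have lc := lam_neq0 cn Ac.
set p := T a a b in p0; set r := T a b b.
have bE : b = (r / p) *: a + (- p^-1) *: third_point T a b.
  rewrite /third_point -/p -/r scalerBr !scalerA addrA -scalerDl mulNr (mulrC r) subrr scale0r add0r.
  by rewrite mulNr mulVf// scaleN1r opprK.
have yE : y = t^-1 *: b - (t^-1 * s) *: a.
  by rewrite /b scalerDr !scalerA mulVf// scale1r addrAC subrr add0r.
set c := third_point T a b in cn Ac lc bE.
exists ((lam c)^-1 *: c), (t^-1 * (r / p) - t^-1 * s), (t^-1 * (- p^-1) * lam c);
  split.
- exact: chart_point_normalize.
- apply/eqP => e; have : indep a c.
    have := @indep_comb R a b 1 0 r (- p) ab;
      rewrite scale1r scale0r addr0 scaleNr -/c; apply.
    by rewrite mul1r mul0r subr0 oppr_eq0.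
  move=> /(_ 1 (- (lam c)^-1));
    rewrite scale1r scaleNr {1}e subrr => /(_ erefl)[/eqP].
  by rewrite oner_eq0.
- by rewrite yE bE scalerDr !scalerA mulfK// scalerBl addrAC.
Qed.

(** The intersection of the open half-spaces bounded by the tangent planes of [A]. *)
Definition inner y := forall a, chart_point a -> T a a y < 0.

(** A line from a point [a] of [A] to [y] is not tangent, so it has a second point
    [a'] in [A].  The conditions [T a a y < 0] and [T a' a' y < 0] give the signs
    of the coordinates of [y] on [a] and [a']. *)
Lemma inner_between y a : lam y = 1 -> inner y -> chart_point a ->
  exists a' s, [/\ chart_point a', 0 <= s <= 1 & y = (1 - s) *: a + s *: a'].
Proof.
move=> ly iy Aa; have [|a' [s [t [Aa' ne yE]]]] := @second_point a y Aa.
  by rewrite lt_eqF// iy.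
have st : s + t = 1 by move: ly; rewrite yE lam_lin Aa.1 Aa'.1 !mulr1.
have h := oval_support Aa Aa' ne.
have h' : T a' a' a < 0 by apply: oval_support => //; rewrite eq_sym.
have t0 : 0 < t.
  have := iy a Aa; rewrite yE !(triE pT) (chart_point_cubic Aa) mulr0 add0r.
  by rewrite nmulr_llt0.
have s0 : 0 < s.
  have := iy a' Aa'; rewrite yE !(triE pT) (chart_point_cubic Aa') mulr0 addr0.
  by rewrite nmulr_llt0.
exists a', t; split=> //; first by apply/andP; split; lra.
by rewrite yE; congr (_ *: _ + _); lra.
Qed.

Lemma between_inner a a' s : chart_point a -> chart_point a' -> a != a' ->
  0 < s < 1 ->
  inner ((1 - s) *: a + s *: a').
Proof.
move=> Aa Aa' ne /andP[s0 s1] c Ac; rewrite !(triE pT).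
have s1' : 0 < 1 - s by rewrite subr_gt0.
have h := oval_support_le Ac Aa; have h' := oval_support_le Ac Aa'.
have [ca|ca] := eqVneq c a.
  by rewrite ca (chart_point_cubic Aa) mulr0 add0r pmulr_rlt0// oval_support.
by rewrite ltr_wnDr// ?pmulr_rlt0// ?oval_support// pmulr_rle0.
Qed.

Lemma between_inner_or a a' s : chart_point a -> chart_point a' -> 0 <= s <= 1 ->
  inner ((1 - s) *: a + s *: a') \/ chart_point ((1 - s) *: a + s *: a').
Proof.
move=> Aa Aa' /andP[s0 s1]; have [<-|ne] := eqVneq a a'.
  by right; rewrite -scalerDl subrK scale1r.
have [sz|sn] := eqVneq s 0; first by right; rewrite sz subr0 scale1r scale0r addr0.
have [so|sm] := eqVneq s 1; first by right; rewrite so subrr scale0r add0r scale1r.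
by left; apply: between_inner => //; rewrite !lt_neqAle eq_sym sn sm s0 s1.
Qed.

Lemma unitmx_col n (l : 'cV[R]_n.+1) : l != 0 ->
  exists2 M : 'M[R]_n.+1, M \in unitmx & M *m l = delta_mx ord0 ord0.
Proof.
move=> l0; have rl : \rank l = 1%N.
  by apply/eqP; rewrite eqn_leq rank_leq_col lt0n mxrank_eq0.
set r := row_ebase l ord0 ord0.
have rE : row_ebase l = r%:M by exact: mx11_scalar.
have r0 : r != 0.
  by have := row_ebase_unit l; rewrite rE unitmxE det_scalar1 unitfE.
exists (r^-1 *: invmx (col_ebase l)).
  by rewrite unitmxZ ?unitmx_inv ?col_ebase_unit// unitfE invr_eq0.
rewrite -[X in _ *m X = _](mulmx_ebase l) rl rE -!scalemxAl !mulmxA mulVmx ?col_ebase_unit// mul1mx.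
rewrite mul_mx_scalar scalerA mulVf// scale1r.
by apply/matrixP => i j; rewrite !mxE ord1 /=; case: i => [[|i] hi].
Qed.

Lemma exists_chart : exists2 M : 'M[R]_4, M \in unitmx &
  (forall r (x : W), lam (row_mx (r%:M : 'M[R]_1) x *m M) = r).
Proof.
pose l : 'cV[R]_4 := \col_i lam (delta_mx ord0 i).
have lE y : lam y = (y *m l) ord0 ord0.
  by rewrite /lam (tri_sum pT) mxE; apply: eq_bigr => i _; rewrite mxE.
have [a [a0 Aa]] := split_nonzero (split_nel sp).
have l0 : l != 0.
  by apply: contraNneq (lam_neq0 a0 Aa) => l0; rewrite lE l0 mulmx0 mxE.
have [M Mu Ml] := unitmx_col l0; exists M => // r x.
rewrite lE -mulmxA Ml mxE (bigD1 ord0)//= big1 => [|i i0].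
  rewrite addr0 [delta_mx _ _ _ _]mxE eqxx mulr1.
  have := row_mxEl (r%:M : 'M[R]_1) x ord0 ord0;
    rewrite [in X in _ = X]mxE mulr1n => rE; rewrite -[RHS]rE.
  by congr (fun_of_matrix _ _ _); apply: val_inj.
by rewrite [delta_mx _ _ _ _]mxE (negPf i0) mulr0.
Qed.

(** The body is the union of the chords of [A]: as the image of a compact set it is
    compact, and as the union of [A] and of the intersection [U] of the tangent
    half-spaces it is convex with interior [U]. *)
Lemma is_convex_left : is_convex A.
Proof.
have [M Mu lM] := exists_chart.
pose g (r : R) (x : W) : V := row_mx (r%:M : 'M[R]_1) x *m M.
have gD r r' (x x' : W) t t' : g (t * r + t' * r') (t *: x + t' *: x') = t *: g r x + t' *: g r' x'.
  by rewrite /g !scalemxAl -mulmxDl !scale_row_mx add_row_mx !scale_scalar_mx -raddfD.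
have gZ t r (x : W) : g (t * r) (t *: x) = t *: g r x.
  by have := gD r r x x t 0; rewrite !scale0r mul0r !addr0.
have lg r (x : W) : lam (g r x) = r by exact: lM.
have g1 (x : W) : g 1 x != 0 by exact/lam1_neq0/lg.
have g_inj r (x : W) : g r x = 0 -> x = 0.
  move=> /(congr1 (mulmx^~ (invmx M))); rewrite mulmxK// mul0mx => e.
  have : row_mx (r%:M : 'M[R]_1) x = row_mx 0 0 by rewrite row_mx0.
  by move=> /eq_row_mx[_ ->].
have g_surj y : exists x : W, y = g (lam y) x.
  exists (rsubmx (y *m invmx M : 'M[R]_(1, 1 + 3))).
  have yE : y = row_mx (lsubmx (y *m invmx M : 'M[R]_(1, 1 + 3))) (rsubmx (y *m invmx M : 'M[R]_(1, 1 + 3))) *m M.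
    by rewrite hsubmxK mulmxKV.
  move: yE; rewrite [lsubmx _]mx11_scalar; set c := lsubmx _ _ _ => yE.
  by have lc := lM c (rsubmx (y *m invmx M : 'M[R]_(1, 1 + 3))); rewrite -yE in lc;
    rewrite lc.
pose M0 : V := usubmx (M : 'M[R]_(1 + 3, 4)).
pose M1 : 'M[R]_(3, 4) := dsubmx (M : 'M[R]_(1 + 3, 4)).
have gE r (x : W) : g r x = r *: M0 + x *m M1.
  by rewrite /g -{1}[M](@vsubmxK _ 1 3) mul_row_col mul_scalar_mx.
have g_cont : continuous (fun q : W * R => g q.2 q.1).
  rewrite (_ : (fun _ => _) = (fun q : W * R => q.2 *: M0 + q.1 *m M1)); last first.
    by apply/funext => q; exact: gE.
  move=> q; apply: continuous_at_add.
    by apply: continuous_at_scale; [exact: cvg_snd|exact: cst_continuous].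
  apply: (@continuous_comp _ _ _ fst (fun x : W => x *m M1)); first exact: cvg_fst.
  exact: mulmx_row_continuous.
have g1_cont : continuous (g 1).
  rewrite (_ : g 1 = (fun x : W => 1 *: M0 + x *m M1)); last by apply/funext => q;
    exact: gE.
  move=> x; apply: continuous_at_add; first exact: cst_continuous.
  exact: mulmx_row_continuous.
pose A3 : set W := [set x | A (ppoint (g 1 x))].
have A3P x : A3 x <-> chart_point (g 1 x) by split=> [h|[]//]; split.
have A3cone : A3 = g 1 @^-1` cone A.
  by apply/seteqP; split=> x /=; rewrite /A3 /= cone_ppoint.
have clA3 : closed A3.
  by rewrite A3cone; apply: closed_preimage g1_cont (closed_cone (split_closedl sp)).
(* [A] does not meet the plane at infinity, so it is bounded in the chart. *)
have cA3 : compact A3.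
  apply: bounded_closed_compact => //.
  have := compact_tube (y0 := (0 : R)) (@sphere_compact R 3) (closed_preimage g_cont (closed_cone (split_closedl sp))).
  case=> [v /= v1|e /= e0 He].
    have gv0 : g 0 v != 0.
      by apply/eqP => /g_inj v0; move: v1; rewrite v0 normr0 => /eqP;
        rewrite eq_sym oner_eq0.
    by rewrite cone_ppoint// => /(lam_neq0 gv0); rewrite lg eqxx.
  exists e^-1; split=> [|m em x Ax /=]; first exact: num_real.
  rewrite leNgt; apply/negP => mx.
  have ex : e^-1 < `|x| by apply: lt_trans mx.
  have x0 : 0 < `|x| by apply: lt_trans ex; rewrite invr_gt0.
  have := He `|x|^-1; rewrite /ball /= sub0r normrN normfV normr_id.
  rewrite invf_plt ?posrE// => /(_ ex) /(_ (`|x|^-1 *: x)); apply.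
    by rewrite /= normrZ normfV normr_id mulVf// gt_eqF.
  rewrite /= -[X in g X]mulr1 gZ; apply: homogeneous_cone;
    first by rewrite invr_eq0 gt_eqF.
  exact/cone_ppoint.
pose U : set W := [set x | inner (g 1 x)].
(* An intersection of open half-spaces indexed by a compact set is open. *)
have oU : open U.
  rewrite openE => x Ux /=.
  pose C : set (W * W) := [set q | 0 <= T (g 1 q.1) (g 1 q.1) (g 1 q.2)].
  have cC : closed C.
    have c1 : continuous (fun q : W * W => g 1 q.1).
      by move=> q; apply: (@continuous_comp _ _ _ fst (g 1));
        [exact: cvg_fst|exact: g1_cont].
    have c2 : continuous (fun q : W * W => g 1 q.2).
      by move=> q; apply: (@continuous_comp _ _ _ snd (g 1));
        [exact: cvg_snd|exact: g1_cont].
    apply: closed_ge0 => q.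
    exact: (pol_continuous pT (f := fun q : W * W => g 1 q.1) (c1 q) (c1 q) (c2 q)).
  have : \forall y \near x, forall c, A3 c -> ~ C (c, y).
    by apply: (compact_tube cA3 cC) => c /A3P Ac; apply/negP; rewrite -ltNge;
      exact: Ux.
  apply: filterS => y Hy a [la Aa].
  have [c cE] := g_surj a; rewrite la in cE.
  have /Hy : A3 c by rewrite /A3 /= -cE.
  by rewrite /C /= -cE => /negP; rewrite -ltNge.
pose K : set W := U `|` A3.
have KE : K = (fun q : W * W * R => (1 - q.2) *: q.1.1 + q.2 *: q.1.2) @` ((A3 `*` A3) `*` `[0, 1]).
  apply/seteqP; split=> [x|_ [[[x x'] s] [[/= Ax Ax'] s01] <-]].
    have [a0 [a0n Aa0]] := split_nonzero (split_nel sp).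
    case=> [Ux|Ax]; last first.
      exists ((x, x), 0); first by split=> //=; rewrite in_itv /= lexx ler01.
      by rewrite /= subr0 scale1r scale0r addr0.
    have aa := chart_point_normalize a0n Aa0;
      have [c cE] := g_surj ((lam a0)^-1 *: a0).
    rewrite aa.1 in cE; rewrite cE in aa.
    have [a' [s [Aa' s01 xE]]] := inner_between (lg 1 x) Ux aa.
    have [c' c'E] := g_surj a'; rewrite Aa'.1 in c'E.
    exists ((c, c'), s).
      by split; [split; [exact: aa.2|rewrite /= /A3 /= -c'E;
        exact: Aa'.2]|rewrite /= in_itv].
    apply/eqP; rewrite -subr_eq0; apply/eqP/(@g_inj 0) => /=.
    have := gD 1 1 ((1 - s) *: c + s *: c') x 1 (-1).
    rewrite !mulr1 !scale1r !scaleN1r subrr => ->.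
    by rewrite xE c'E -gD !mulr1 subrK subrr.
  move: s01; rewrite /= in_itv /= => s01.
  have := between_inner_or (proj1 (A3P _) Ax) (proj1 (A3P _) Ax') s01.
  by rewrite -gD !mulr1 subrK => -[?|/A3P]; [left|right].
have cK : compact K.
  rewrite KE; apply: continuous_compact; last first.
    by apply: compact_setX; [exact: compact_setX|exact: segment_compact].
  apply: continuous_subspaceT => q.
  have c2 : continuous_at q (fun q : W * W * R => q.2) by exact: cvg_snd.
  have c11 : continuous_at q (fun q : W * W * R => q.1.1).
    by apply: (@continuous_comp _ _ _ fst fst); [exact: cvg_fst|exact: cvg_fst].
  have c12 : continuous_at q (fun q : W * W * R => q.1.2).
    by apply: (@continuous_comp _ _ _ fst snd); [exact: cvg_fst|exact: cvg_snd].
  apply: continuous_at_add; apply: continuous_at_scale => //.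
  apply: continuous_at_add; first exact: cst_continuous.
  exact: continuous_at_opp.
have Kle x a : K x -> chart_point a -> T a a (g 1 x) <= 0.
  move=> [Ux|/A3P Ax] Aa; first exact/ltW/Ux.
  exact: oval_support_le.
have Klt x a : K x -> chart_point a -> a != g 1 x -> T a a (g 1 x) < 0.
  by move=> [Ux|/A3P Ax] Aa ne; [exact: Ux|exact: oval_support].
(* Moving from [x] to the outer side of its tangent plane leaves [K]. *)
have A3int x : A3 x -> ~ K° x.
  move=> /A3P Ax Kx; have Fx := chart_point_cubic Ax.
  have [v tv] := smooth_tri pT sF (g1 x) Fx.
  set a := g 1 x in Ax Fx tv *.
  pose w := T a a v *: (v - lam v *: a).
  have lw : lam w = 0.
    have := lam_lin 1 (- lam v) v a; rewrite scale1r scaleNr => e.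
    by rewrite /w lamZ e Ax.1 mul1r mulr1 subrr mulr0.
  have tw : 0 < T a a w.
    rewrite /w (triZ3 pT) -scaleNr (triD3 pT) (triZ3 pT) Fx mulr0 addr0 -expr2.
    by rewrite exprn_even_gt0.
  have [d dE] := g_surj w; rewrite lw in dE.
  pose f t := x + t *: d.
  have cf : continuous f.
    move=> t; apply: continuous_at_add; first exact: cst_continuous.
    by apply: continuous_at_scale; [exact: cvg_id|exact: cst_continuous].
  have : nbhs (0 : R) (f @^-1` K) by apply: cf; rewrite /f scale0r addr0.
  case=> e /= e0 He; have e2 : 0 < e / 2 by rewrite divr_gt0.
  have : K (f (e / 2)).
    by apply: He; rewrite /ball /= sub0r normrN gtr0_norm// ltr_pdivrMr// ltr_pMr// ltr1n.
  move=> /Kle/(_ Ax); rewrite leNgt => /negP; apply.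
  have -> : g 1 (f (e / 2)) = a + (e / 2) *: w.
    by have := gD 1 0 x d 1 (e / 2); rewrite mulr1 mulr0 addr0 !scale1r -dE => <-.
  by rewrite (triD3 pT) (triZ3 pT) Fx add0r mulr_gt0.
have UK : U `<=` K° by rewrite -open_subsetE// => x; left.
have cloK : closed K := compact_closed (@norm_hausdorff _ _) cK.
have clK : closure K = K := esym ((closure_id K).1 cloK).
exists M, K; split=> //.
- apply/convex_setW => x y /set_mem Kx /set_mem Ky k k0 k1; apply/mem_set.
  have [->|xy] := eqVneq x y; first by rewrite convmm.
  left=> a Aa; rewrite (_ : g 1 _ = k%:num *: g 1 x + (1 - k%:num) *: g 1 y);
    last first.
    by rewrite -gD !mulr1 addrC subrK.
  have k1' : 0 < 1 - k%:num by rewrite subr_gt0.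
  rewrite (triD3 pT) !(triZ3 pT).
  have [ax|ax] := eqVneq a (g 1 x); last first.
    by rewrite ltr_wnDr// ?pmulr_rlt0 ?Klt// pmulr_rle0// Kle.
  rewrite ltr_wnDl// ?pmulr_rlt0 ?Klt// ?pmulr_rle0// ?Kle// ax.
  apply: contra_neq xy => e; apply/eqP; rewrite -subr_eq0; apply/eqP/(@g_inj 0).
  have := gD 1 1 x y 1 (-1).
  by rewrite !mulr1 !scale1r !scaleN1r subrr => ->; rewrite e subrr.
- have [a0 [a0n Aa0]] := split_nonzero (split_nel sp).
  have aa := chart_point_normalize a0n Aa0.
  have [v tv] := smooth_tri pT sF (lam1_neq0 aa.1) (chart_point_cubic aa).
  have [a' [s [t [Aa' ne _]]]] := second_point aa tv.
  set a := (lam a0)^-1 *: a0 in aa ne.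
  have [c cE] := g_surj a; rewrite aa.1 in cE.
  have [c' c'E] := g_surj a'; rewrite Aa'.1 in c'E.
  exists ((1 - 2^-1) *: c + 2^-1 *: c'); apply: UK.
  rewrite /U /= (_ : g 1 _ = (1 - 2^-1) *: g 1 c + 2^-1 *: g 1 c'); last first.
    by rewrite -gD !mulr1 subrK.
  by rewrite -cE -c'E; apply: between_inner => //; apply/andP; split; lra.
- rewrite clK; apply/seteqP; split=> P.
    move=> AP; have hn := hcoord_neq0 P.
    have Ah : A (ppoint (hcoord P)) by rewrite hcoordK.
    have aa := chart_point_normalize hn Ah.
    have [x xE] := g_surj ((lam (hcoord P))^-1 *: hcoord P); rewrite aa.1 in xE.
    have Ax : A3 x by rewrite /A3 /= -xE; exact: aa.2.
    exists x; first by split; [right|exact: A3int].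
    apply: (colinear_eqmx (lam_neq0 hn Ah));
      rewrite -/(g 1 x) -xE scalerA mulfV ?scale1r//.
    exact: lam_neq0.
  move=> [x [Kx nKx] /eqmx_colinear[k k0 hE]].
  have Ax : A3 x by case: Kx => // /UK.
  by rewrite -[P]hcoordK hE -/(g 1 x) ppointZ.
Qed.
End Convex.

(** * The parity isomorphism *)

Section Final.
Context (R : realType).
Local Notation V := 'rV[R]_4.
Context (F : mpoly 4 R).

Lemma GS_additive_ext (M : zmodType) (f g : GS F -> M) :
  additive f -> additive g -> (forall P, f (pt P) = g (pt P)) -> f =1 g.
Proof.
move=> af ag fg D.
pose f' : {additive GS F -> M} := HB.pack f (GRing.isAdditive.Build _ _ f af).
pose g' : {additive GS F -> M} := HB.pack g (GRing.isAdditive.Build _ _ g ag).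
rewrite -[f]/(f' : _ -> _) -[g]/(g' : _ -> _) -(freeg_sumE D) !raddf_sum.
apply: eq_bigr => P _.
by rewrite -[coeff P D]intz -freegU_mulz !raddfMz; congr (_ *~ _); exact: fg.
Qed.

Definition count_in (A : set (P3 R)) (D : GS F) : int :=
  fglift (fun P : real_points F => (`[< A (val P) >] : nat)%:Z : int^o) D.

Lemma count_in_additive A : additive (count_in A).
Proof. exact: (@lift_is_additive _ _ int^o _). Qed.

HB.instance Definition _ A := GRing.isAdditive.Build (GS F) int (count_in A) (count_in_additive A).

Lemma count_in_pt A P : count_in A (pt P) = `[< A (val P) >].
Proof. by rewrite /count_in /pt liftU /GRing.scale /= mul1r. Qed.

Lemma count_inD A : {morph count_in A : x y / x + y}.
Proof. exact: raddfD. Qed.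

Lemma cls_additive : additive (@cls R F).
Proof. by move=> x y; exact: raddfB. Qed.

Lemma deg_additive : additive (@Defs.deg R F).
Proof. by move=> x y; exact: degB. Qed.

(** It is enough to compare two morphisms on points. *)
Lemma cls_formula A (z e : HS F) :
  (forall P : real_points F, cls (pt P) = z + e *+ `[< A (val P) >]) ->
  forall D, cls D = z *~ Defs.deg D + e *~ count_in A D.
Proof.
move=> H; apply: GS_additive_ext.
- exact: cls_additive.
- by move=> x y; rewrite deg_additive count_in_additive !mulrzBr addrACA opprD.
- by move=> P; rewrite H count_in_pt /Defs.deg degU mulr1z pmulrn.
Qed.

Lemma HS0_repr (x : HS0 F) : exists2 D : GS F, val x = cls D & Defs.deg D = 0.
Proof. by exists (repr (val x)); [rewrite /cls reprK|exact/eqP/(valP x)]. Qed.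

Lemma HS0_eq0 (x : HS0 F) : val x = 0 -> x = 0.
Proof. by move=> x0; apply: val_inj; rewrite x0. Qed.

Lemma HS0_trivial (z : HS F) :
  (forall P : real_points F, cls (pt P) = z) -> forall x : HS0 F, x = 0.
Proof.
move=> H x; apply: HS0_eq0; have [D -> dD] := HS0_repr x.
rewrite (@cls_formula set0 z 0) ?dD ?mulr0z ?mul0rz ?addr0// => P.
by rewrite mul0rn addr0 H.
Qed.

Definition mod2 (n : int) : 'Z_2 := n%:~R.

Lemma mod2_eq0 n : mod2 n = 0 -> exists m, n = m * 2.
Proof.
have e2 : (2 : int)%:~R = 0 :> 'Z_2 by exact: val_inj.
rewrite /mod2 {1}(divz_eq n 2) intrD intrM e2 mulr0 add0r.
have := modz_ge0 n (isT : 2 != 0 :> int); have := ltz_pmod n (isT : 0 < 2 :> int).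
case E : (n %% 2)%Z => [[|[|k]]|k] //.
move=> _ _ _; exists (n %/ 2)%Z; by rewrite {1}(divz_eq n 2) E addr0.
Qed.

Lemma count_in_GS' A D : (forall P Q Q', line_triple F P Q Q' ->
     ~~ odd (`[< A P >] + `[< A Q >] + `[< A Q' >])) ->
  GS' D -> mod2 (count_in A D) = 0.
Proof.
move=> H GD; apply: (GD [set D | mod2 (count_in A D) = 0]); split.
  split; first by rewrite /= /mod2 raddf0.
  by move=> x y /= hx hy; rewrite /mod2 raddfB intrB -!/(mod2 _) hx hy subrr.
move=> _ [P [Q [Q' [-> lin]]]]; rewrite /= /mod2 !count_inD !count_in_pt -!PoszD.
have := H _ _ _ lin; set n := (_ + _)%N => /even_halfK <-.
by rewrite -muln2 PoszM intrM; apply/val_inj; rewrite /= muln0.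
Qed.

Section Iso.
Context (A : set (P3 R)) (z e : HS F).
Context (even_lines : forall P Q Q', line_triple F P Q Q' ->
  ~~ odd (`[< A P >] + `[< A Q >] + `[< A Q' >])).
Context (cls_pt : forall P : real_points F,
  cls (pt P) = z + e *+ `[< A (val P) >]).
Context (e2 : e *+ 2 = 0).

Definition parity (x : HS0 F) : 'Z_2 := mod2 (count_in A (repr (val x))).

Lemma parity_cls x D : val x = cls D -> parity x = mod2 (count_in A D).
Proof.
move=> xD; apply/eqP; rewrite -subr_eq0 /parity /mod2 -intrB -raddfB; apply/eqP.
apply: count_in_GS' even_lines _.
have : cls (repr (val x)) = cls D by rewrite -xD /cls reprK.
by move=> /eqP; rewrite /cls -Quotient.idealrBE => /asboolP[].
Qed.

Lemma parity_additive : additive parity.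
Proof.
move=> x y; have [Dx xE _] := HS0_repr x; have [Dy yE _] := HS0_repr y.
rewrite (parity_cls xE) (parity_cls yE) (@parity_cls _ (Dx - Dy)).
  by rewrite /mod2 raddfB intrB.
by rewrite raddfB /= xE yE; exact/esym/cls_additive.
Qed.

HB.instance Definition _ := GRing.isAdditive.Build (HS0 F) 'Z_2 parity parity_additive.

Definition parity_hom : {additive HS0 F -> 'Z_2} := parity.

Lemma parity_cls_sub P P0 : parity (cls_sub P P0) =
  (`[< A (val P) >])%:R - (`[< A (val P0) >])%:R.
Proof.
rewrite (@parity_cls _ (pt P - pt P0))//.
by rewrite /mod2 raddfB /= !count_in_pt intrB.
Qed.

Lemma parity_inj : injective parity.
Proof.
apply: raddf_inj => x; have [D xD dD] := HS0_repr x.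
move=> px; have : parity x = 0 := px; rewrite (parity_cls xD) => /mod2_eq0[m mE];
  apply: HS0_eq0.
have e2z : e *~ 2 = 0 by exact: e2.
by rewrite xD (cls_formula cls_pt) dD mulr0z add0r mE mulrC mulrzA e2z mul0rz.
Qed.

Lemma parity_bij (P P0 : real_points F) : A (val P) -> ~ A (val P0) ->
  bijective parity.
Proof.
move=> AP nAP0.
have h1 : parity (cls_sub P P0) = 1.
  by rewrite parity_cls_sub (asboolT AP) (asboolF nAP0) subr0.
pose g (c : 'Z_2) : HS0 F := if c == 0 then 0 else cls_sub P P0.
have gK c : parity (g c) = c.
  rewrite /g; have [->|c0] := eqVneq c 0; first exact: raddf0.
  rewrite h1; apply: val_inj; move: c0; case: c => [[|[|]]]//.
by exists g => // x; apply: parity_inj; rewrite gK.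
Qed.
End Iso.
End Final.

(** * Components of the surface *)

Section Components.
Context (R : realType).
Local Notation V := 'rV[R]_4.
Context (F : mpoly 4 R) (T : V -> V -> V -> R) (pT : polarization F T).
Local Notation cub x := (T x x x).

Lemma closed_real_points : closed (real_points F).
Proof.
rewrite (_ : real_points F = [set P | [set x : V | cub x = 0] (hcoord P)]);
  last first.
  by apply/seteqP; split=> P /(real_pointsE pT).
apply: closed_hcoord.
  by move=> k x k0 /=; rewrite (cubicZ pT) => ->; rewrite mulr0.
by apply: closed_eq0; poly_cont pT.
Qed.

Lemma comp_of_eq (A : set (P3 R)) (P : real_points F) :
  components (real_points F) A -> A (val P) -> comp_of P = A.
Proof. by move=> [Q SQ <-] QP; rewrite /comp_of;
  apply/esym/same_connected_component. Qed.

Lemma component_or (A B : set (P3 R)) : components (real_points F) A ->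
  components (real_points F) B -> A = B \/ (forall P, A P -> ~ B P).
Proof.
move=> [Q SQ <-] [Q' SQ' <-].
have [[P [h1 h2]]|n] := pselect (exists P, connected_component (real_points F) Q P /\
    connected_component (real_points F) Q' P).
  by left; rewrite (same_connected_component h1) (same_connected_component h2).
by right=> P h1 h2; apply: n; exists P.
Qed.

Lemma one_component : components (real_points F) #= `I_1 ->
  connected (real_points F) /\ real_points F !=set0.
Proof.
move=> /card_esym/card_set_bijP[f [fS _ fsur]].
have [P SP fP] : components (real_points F) (f 0%N) by apply: fS.
have sub : real_points F `<=` connected_component (real_points F) P.
  move=> Q SQ; have [n n1 nE] := fsur _ (ex_intro2 _ _ Q SQ erefl).
  move: nE; have -> : n = 0%N by move: n1 => /=; case: n.
  by rewrite -fP => ->; exact: connected_component_refl.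
have <- : connected_component (real_points F) P = real_points F.
  by apply/seteqP; split => //; exact: connected_component_sub.
by split; [exact: component_connected|exists P; exact: connected_component_refl].
Qed.

Lemma two_components : components (real_points F) #= `I_2 ->
  exists A B, [/\ splitting F A B, components (real_points F) A & components (real_points F) B].
Proof.
move=> /card_esym/card_set_bijP[f [fS finj fsur]].
have cA : components (real_points F) (f 0%N) by apply: fS.
have cB : components (real_points F) (f 1%N) by apply: fS.
exists (f 0%N), (f 1%N); split=> //.
have facts A : components (real_points F) A ->
    [/\ connected A, closed A, A !=set0 & A `<=` real_points F].
  move=> [P SP <-]; split.
  - exact: component_connected.
  - exact: component_closed closed_real_points.
  - by exists P; exact: connected_component_refl.
  - exact: connected_component_sub.
have [h1 h2 h3 h4] := facts _ cA; have [k1 k2 k3 k4] := facts _ cB.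
split=> //.
  apply/seteqP; split=> [P SP|P [/h4|/k4]]//.
  have [n n2 nE] := fsur _ (ex_intro2 _ _ P SP erefl).
  have : f n P by rewrite nE; exact: connected_component_refl.
  by move: n2 => /=; case: n {nE} => [|[|]]//; [left|right].
have [e|//] := component_or cA cB.
by have := finj 0%N 1%N; rewrite !inE /= => /(_ isT isT e).
Qed.

(** The class of a point is the base class [z] on [B] and [z + e] on [A], where
    [2 e = 0] by [class_double]. *)
Lemma oval_isomorphism A B : splitting F A B -> oval T A B ->
  exists phi : {additive HS0 F -> 'Z_2}, bijective phi /\
    forall P P0 : real_points F, ~ A (val P0) -> phi (cls_sub P P0) = (`[< A (val P) >])%:R.
Proof.
move=> sp ov.
have [a [a0 Aa]] := split_nonzero (split_nel sp).
have [b [b0 Bb]] := split_nonzero (split_ner sp).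
have Fa := splitl_cubic pT sp a0 Aa; have Fb := splitr_cubic pT sp b0 Bb.
pose z := line_class F - point_class F (ppoint a) *+ 2.
pose e := point_class F (ppoint a) - z.
have zE x : base_class F T x -> point_class F (ppoint x) = z.
  by move=> /(_ a a0 Fa); rewrite /z => <-; rewrite addrC addKr.
have e2 : e *+ 2 = 0.
  rewrite /e mulrnBl;
    have -> : point_class F (ppoint a) *+ 2 = point_class F (ppoint b) *+ 2.
    exact: (class_double pT a0 b0 Fa Fb).
  by rewrite (zE b) ?subrr//; exact: (oval_base_class pT sp ov).
have cls_pt (P : real_points F) : cls (pt P) = z + e *+ `[< A (val P) >].
  have hn := hcoord_neq0 (val P).
  have SP : real_points F (val P) by exact: set_mem (valP P).
  rewrite -point_class_val -[val P]hcoordK; case: asboolP => [AP|nAP].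
    by rewrite mulr1n /e addrC subrK; apply: (oval_same_class pT sp ov).
  rewrite mulr0n addr0; apply: zE; apply: (oval_base_class pT sp ov) => //.
  by move: nAP; rewrite hcoordK; case: (split_mem sp SP).
have par := oval_parity pT sp ov.
have SaP : real_points F (ppoint a) by rewrite (split_cover sp); left.
have SbP : real_points F (ppoint b) by rewrite (split_cover sp); right.
exists (parity_hom par); split.
  apply: (parity_bij par cls_pt e2 (P := SigSub (mem_set SaP)) (P0 := SigSub (mem_set SbP))) => //=.
  by move=> /(split_disjoint sp).
move=> P P0 nA; rewrite [LHS](parity_cls_sub par).
by rewrite (asboolF nA) subr0.
Qed.
End Components.

Theorem theorem9 (R : realType) (F : mpoly.mpoly 4 R) (hF : smooth_cubic F) :
  (components (real_points F) #= `I_1 -> forall x : HS0 F, x = 0) /\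
  (components (real_points F) #= `I_2 ->
    (exists phi : {additive HS0 F -> 'Z_2}, bijective phi) /\
    (forall P0 : real_points F, ~ is_convex (comp_of P0) ->
      exists phi : {additive HS0 F -> 'Z_2}, bijective phi /\
        forall P : real_points F,
          (~ is_convex (comp_of P) -> phi (cls_sub P P0) = 0) /\
          (is_convex (comp_of P) -> phi (cls_sub P P0) = 1))).
Proof.
have [hom /smooth_real sF] := hF; have [T pT] := exists_polarization hom.
split=> [/one_component[cS [P0 SP0]]|/(two_components pT)[A [B [sp cA cB]]]].
  apply: (@HS0_trivial R F (line_class F - point_class F P0 *+ 2)) => P.
  have SP : real_points F (val P) by exact: set_mem (valP P).
  have := connected_base_class pT cS (hcoord_neq0 (val P)) ((real_pointsE pT _).1 SP).
  move=> /(_ _ (hcoord_neq0 P0) ((real_pointsE pT _).1 SP0)).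
  by rewrite !hcoordK point_class_val => <-; rewrite addrC addKr.
wlog ov : A B sp cA cB / oval T A B.
  move=> H; have [ov|ov] := oval_or pT sp; first exact: H ov.
  exact: H (splittingC sp) cB cA ov.
have [phi [phi_bij phiE]] := oval_isomorphism pT sp ov.
split; first by exists phi.
have [b [b0 Bb]] := split_nonzero (split_ner sp).
have convA : is_convex A := is_convex_left pT sF sp ov b0 Bb.
have nconvB := is_convex_not_right pT sp ov.
have conv (P : real_points F) : is_convex (comp_of P) <-> A (val P).
  have SP : real_points F (val P) by exact: set_mem (valP P).
  have [AP|BP] := split_mem sp SP.
    by rewrite (comp_of_eq cA AP).
  rewrite (comp_of_eq cB BP); split=> // AP.
  by have := split_disjoint sp AP BP.
move=> P0 /conv nA; exists phi; split=> // P; rewrite phiE//.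
by split=> [/conv h|/conv h]; [rewrite asboolF|rewrite asboolT].
Qed.
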